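(* For every integer $d$ with $d\geq 3$, there is an approximation algorithm for the problem Maximum Induced Matching restricted to $\{C_3,C_5\}$-free $d$-regular graphs with performance ratio $\frac{17}{24}d+\frac{17d}{48d-24}$, and $\frac{17}{24}d+\frac{17d}{48d-24}\leq 0.708\bar{3}\,d+0.425$ (where $0.708\bar{3}=\frac{17}{24}$).
   Context: All graphs are finite, simple, and undirected. A graph is $\{C_3,C_5\}$-free if it has no cycle of length $3$ or $5$. A set $M$ of edges of a graph $G$ is an induced matching of $G$ if the set of vertices of $G$ incident with the edges in $M$ induces a $1$-regular subgraph of $G$. The induced matching number $\nu_2(G)$ is the maximum cardinality of an induced matching of $G$. Maximum Induced Matching is the problem of determining, for a given graph $G$, an induced matching of maximum cardinality $\nu_2(G)$. An approximation algorithm with performance ratio $r$ for this problem restricted to a class of graphs is a polynomial-time algorithm that, for every input graph $G$ in the class, outputs an induced matching $M$ of $G$ with $\nu_2(G)\leq r\,|M|$. *)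

(* Defs.v *)
From mathcomp Require Import all_boot all_order all_algebra.

Set Implicit Arguments.
Unset Strict Implicit.
Unset Printing Implicit Defensive.

Import GRing.Theory Num.Theory.

(** * Graphs *)

Record sgraph (T : finType) := SGraph {
  adj :> rel T;
  adj_sym : symmetric adj;
  adj_irr : irreflexive adj }.

Section Graphs.
Variables (T : finType) (G : sgraph T).

Definition edges : {set {set T}} :=
  [set A | [exists u, exists v, adj G u v && (A == [set u; v])]].

Definition induced_regular (S : {set T}) (k : nat) : bool :=
  [forall v in S, #|[set w in S | adj G v w]| == k].

Definition regular (k : nat) : bool := induced_regular [set: T] k.

(* For k >= 3 this says that G has no (not necessarily induced) cycle of
   length k; [ucycle] demands that the vertices be pairwise distinct. *)
Definition cycle_free (k : nat) : Prop :=
  forall c : seq T, ucycle (adj G) c -> size c <> k.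

Definition induced_matching (M : {set {set T}}) : bool :=
  (M \subset edges) && induced_regular (cover M) 1.

Definition nu2 : nat := \max_(M : {set {set T}} | induced_matching M) #|M|.

End Graphs.

(** * Computation model

   The model is the WHILE language on binary trees (N. D. Jones, Computability
   and Complexity from a Programming Perspective).  A program has finitely many
   variables, each holding a tree.  Evaluating an expression is charged the
   total size of the values of all its subexpressions, rather than one unit
   per operation: repeatedly doubling a tree by [Cons x x] therefore takes
   exponential time, and a multitape Turing machine storing trees as preorder
   strings simulates a run of cost t in time polynomial in t (and in the size
   of the input).  Conversely, Turing machine tapes are pairs of lists, so that
   polynomial time has its usual meaning. *)

Inductive tree := Leaf | Node of tree & tree.

Fixpoint tree_size (t : tree) : nat :=
  if t is Node l r then (tree_size l + tree_size r).+1 else 1.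

Definition hd (t : tree) : tree := if t is Node l _ then l else Leaf.
Definition tl (t : tree) : tree := if t is Node _ r then r else Leaf.

Inductive expr :=
  | Var of nat
  | Nil
  | Cons of expr & expr
  | Hd of expr
  | Tl of expr.

Inductive prog :=
  | Assign of nat & expr
  | Seq of prog & prog
  | If of nat & prog & prog
  | While of nat & prog.

Definition store := nat -> tree.

Definition upd (s : store) (x : nat) (t : tree) : store :=
  fun y => if y == x then t else s y.

Fixpoint eval (s : store) (a : expr) : tree :=
  match a with
  | Var x => s x
  | Nil => Leaf
  | Cons a b => Node (eval s a) (eval s b)
  | Hd a => hd (eval s a)
  | Tl a => tl (eval s a)
  end.

Fixpoint eval_cost (s : store) (a : expr) : nat :=
  tree_size (eval s a) +
  match a with
  | Var _ | Nil => 0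
  | Cons a b => eval_cost s a + eval_cost s b
  | Hd a | Tl a => eval_cost s a
  end.

(* [exec p s t s']: started in store s, the program p halts in store s' after
   time t.  A test of x succeeds when x does not hold [Leaf]. *)
Inductive exec : prog -> store -> nat -> store -> Prop :=
  | ExecAssign x a s :
      exec (Assign x a) s (eval_cost s a).+1 (upd s x (eval s a))
  | ExecSeq p q s t s1 u s2 :
      exec p s t s1 -> exec q s1 u s2 -> exec (Seq p q) s (t + u) s2
  | ExecIfTrue x p q s t s1 :
      s x <> Leaf -> exec p s t s1 -> exec (If x p q) s t.+1 s1
  | ExecIfFalse x p q s t s1 :
      s x = Leaf -> exec q s t s1 -> exec (If x p q) s t.+1 s1
  | ExecWhileTrue x p s t s1 u s2 :
      s x <> Leaf -> exec p s t s1 -> exec (While x p) s1 u s2 ->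
      exec (While x p) s (t + u).+1 s2
  | ExecWhileFalse x p s :
      s x = Leaf -> exec (While x p) s 1 s.

Lemma exec_deterministic p s t1 s1 t2 s2 :
  exec p s t1 s1 -> exec p s t2 s2 -> t1 = t2 /\ s1 = s2.
Proof.
move=> E1; elim: E1 t2 s2 => {p s t1 s1} *;
  match goal with E : exec _ _ _ _ |- _ => inversion E; subst end => //;
  repeat match goal with
  | IH : forall t s', exec ?p ?s t s' -> _, E : exec ?p ?s _ _ |- _ =>
      case: (IH _ _ E) => ? ?; clear E; subst
  end; by [].
Qed.

(* Input and output are passed in variable 0; the others start as [Leaf]. *)
Definition runs (p : prog) (x : tree) (t : nat) (y : tree) : Prop :=
  exists2 s, exec p (upd (fun=> Leaf) 0 x) t s & s 0 = y.

(** * Encodings *)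

Definition enc_seq : seq tree -> tree := foldr Node Leaf.
Definition enc_bool (b : bool) : tree := if b then Node Leaf Leaf else Leaf.
Definition enc_nat (m : nat) : tree := iter m (Node Leaf) Leaf.

(* The adjacency matrix, as a list of rows. *)
Definition enc_graph n (G : sgraph 'I_n) : tree :=
  enc_seq [seq enc_seq [seq enc_bool (adj G i j) | j <- enum 'I_n]
              | i <- enum 'I_n].

(* A set of edges is output as a list of pairs of vertices, in any order.
   Vertices are in unary, which is polynomially bounded in the size of the
   adjacency matrix. *)
Definition encodes_edges n (y : tree) (M : {set {set 'I_n}}) : Prop :=
  exists2 l : seq ('I_n * 'I_n),
    y = enc_seq [seq Node (enc_nat uv.1) (enc_nat uv.2)
          | uv : 'I_n * 'I_n <- l] &
    M = [set [set uv.1; uv.2] | uv : 'I_n * 'I_n in l].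

(** * Approximation algorithms for Maximum Induced Matching *)

Definition graph_class := forall n : nat, sgraph 'I_n -> Prop.

Definition approximation_algorithm (C : graph_class) (r : rat) (p : prog) :
    Prop :=
  exists q : {poly nat}, forall (n : nat) (G : sgraph 'I_n), C n G ->
    exists (t : nat) (y : tree) (M : {set {set 'I_n}}),
      [/\ runs p (enc_graph G) t y,
          t <= (q.[tree_size (enc_graph G)])%R,
          encodes_edges y M,
          induced_matching G M &
          ((nu2 G)%:R <= r * #|M|%:R)%R].

Definition C3C5_free_regular (d : nat) : graph_class :=
  fun n G => [/\ cycle_free G 3, cycle_free G 5 & regular G d].

(* Main.v *)
(* Write n for the order of the graph and c for the conflict relation between
   arcs (ordered edges): two arcs conflict when some end of one is adjacent to
   some end of the other, so that pairwise conflict-free sets of arcs correspond to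
   the induced matchings.

   The algorithm has two phases.  The greedy phase repeatedly adds an arc that
   conflicts with at most 17 d^2 / 6 of the arcs that are still available.
   When it is stuck, the available arcs are those of an induced subgraph H in
   which every arc has more than 17 d^2 / 6 conflicts, and local search in H
   (insert up to two arcs, delete the arcs in conflict with them, keep the result
   if it is larger) produces M.  Every arc of H conflicts with M, and the arcs
   whose only conflict in M is e form a clique P(e) of the conflict relation, so
   twice the number of arcs of H is at most the sum over e in M of
   |C(e)| + |P(e)|, where C(e) is the set of arcs in conflict with e.

   Since H has no closed walk of length 3 or 5, such a clique is, in each of the
   two orientations, a set X of edges ab of a bipartite graph in which any two
   edges ab, a'b' satisfy a ~ b' or a' ~ b.  For such X some edge xy of H has
   |X| <= e(N(x), N(y)) + d^2 / 4, while |C(xy)| <= 4 d^2 - 2 e(N(x), N(y)).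
   As |C(xy)| > 17 d^2 / 6, this yields |P(e)| <= 10 d^2 / 6, so each e in M
   accounts for at most 17 d^2 / 6 arcs of H, as in the greedy phase.
   Hence 6 n d <= 17 d^2 |M| for the final M, to be compared with
   2 nu_2 (2 d - 1) <= n d. *)

Require Import Defs.
From mathcomp Require Import all_boot all_order all_algebra.
From mathcomp Require Import zify ring lra.

Set Implicit Arguments.
Unset Strict Implicit.
Unset Printing Implicit Defensive.

(** * Polynomial-time functions on trees *)

Lemma tree_size_gt0 x : 0 < tree_size x.
Proof. by case: x. Qed.

Lemma leq_wexp2r m n k : m <= n -> m ^ k <= n ^ k.
Proof. by case: k => // k; rewrite leq_exp2r. Qed.

(** One monomial suffices: tree sizes are positive, so a sum of monomials is dominated by a single
    one. *)
Definition polybounded (b : tree -> nat) :=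
  exists c k, forall x, b x <= c * tree_size x ^ k.

Lemma polybounded_le b1 b2 :
  (forall x, b1 x <= b2 x) -> polybounded b2 -> polybounded b1.
Proof.
by move=> le12 [c [k le2]]; exists c, k => x; apply: leq_trans (le2 x).
Qed.

Lemma polybounded_const c : polybounded (fun=> c).
Proof. by exists c, 0 => x; rewrite muln1. Qed.

Lemma polybounded_size : polybounded tree_size.
Proof. by exists 1, 1 => x; rewrite mul1n. Qed.

Lemma polybounded_add b1 b2 :
  polybounded b1 -> polybounded b2 -> polybounded (fun x => b1 x + b2 x).
Proof.
move=> [c1 [k1 le1]] [c2 [k2 le2]]; exists (c1 + c2), (k1 + k2) => x.
rewrite mulnDl leq_add // ?(leq_trans (le1 x)) ?(leq_trans (le2 x)) //.
  by rewrite leq_mul2l leq_pexp2l ?tree_size_gt0 ?leq_addr ?orbT.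
by rewrite leq_mul2l leq_pexp2l ?tree_size_gt0 ?leq_addl ?orbT.
Qed.

Lemma polybounded_mul b1 b2 :
  polybounded b1 -> polybounded b2 -> polybounded (fun x => b1 x * b2 x).
Proof.
move=> [c1 [k1 le1]] [c2 [k2 le2]]; exists (c1 * c2), (k1 + k2) => x.
by rewrite expnD mulnACA leq_mul.
Qed.

Lemma polybounded_exp b k : polybounded b -> polybounded (fun x => b x ^ k).
Proof.
move=> bb; elim: k => [|k IH]; first exact: (polybounded_const 1).
by apply: (polybounded_le _ (polybounded_mul bb IH)) => x; rewrite expnS.
Qed.

Lemma polybounded_comp b (f : tree -> tree) :
  polybounded b -> polybounded (fun x => tree_size (f x)) ->
  polybounded (fun x => b (f x)).
Proof.
move=> [c [k leb]] bf.
have:= polybounded_mul (polybounded_const c) (polybounded_exp k bf).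
by apply: polybounded_le => x; apply: leb.
Qed.

Ltac polybound := repeat first
  [ assumption | apply: polybounded_size | apply: polybounded_const
  | apply: polybounded_add | apply: polybounded_mul | apply: polybounded_exp ].

(** * Timed total-correctness triples and composable programs *)

Definition run (p : prog) (s : store) (T : nat) (Q : store -> Prop) :=
  exists t s', [/\ exec p s t s', t <= T & Q s'].

Lemma run_seq p q s T1 T2 Q1 (Q2 : store -> Prop) :
  run p s T1 Q1 -> (forall s1, Q1 s1 -> run q s1 T2 Q2) ->
  run (Seq p q) s (T1 + T2) Q2.
Proof.
move=> [t1 [s1 [e1 l1 q1]]] /(_ _ q1) [t2 [s2 [e2 l2 q2]]].
by exists (t1 + t2), s2; split; [apply: ExecSeq e1 e2 | apply: leq_add |].
Qed.

Lemma run_assign x a s (Q : store -> Prop) :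
  Q (upd s x (eval s a)) -> run (Assign x a) s (eval_cost s a).+1 Q.
Proof. by exists (eval_cost s a).+1, (upd s x (eval s a)); split; first exact: ExecAssign. Qed.

Lemma run_weaken p s T1 T2 Q1 (Q2 : store -> Prop) :
  run p s T1 Q1 -> T1 <= T2 -> (forall s1, Q1 s1 -> Q2 s1) -> run p s T2 Q2.
Proof.
move=> [t [s1 [e l q]]] le12 sub; exists t, s1; split=> //; last exact: sub.
exact: leq_trans le12.
Qed.

(* [P r] computes f in place in register r, using the registers above r as
   scratch space (whatever they contain) and preserving those below r: this
   makes programs compose without renaming variables. *)
Definition polytime (f : tree -> tree) :=
  polybounded (fun x => tree_size (f x)) /\
  exists P T, polybounded T /\ forall r s,
    run (P r) s (T (s r))
      (fun s' => (forall i, i < r -> s' i = s i) /\ s' r = f (s r)).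

Lemma polytime_ext f g : f =1 g -> polytime f -> polytime g.
Proof.
move=> eq_fg [bf [P [T [bT Pf]]]]; split.
  by apply: polybounded_le bf => x; rewrite eq_fg.
exists P, T; split=> // r s; rewrite -eq_fg; exact: Pf.
Qed.

Lemma upd_eq s x t : upd s x t x = t.
Proof. by rewrite /upd eqxx. Qed.

Lemma upd_neq s x t y : y != x -> upd s x t y = s y.
Proof. by rewrite /upd => /negPf->. Qed.

Lemma polytime_size f : polytime f -> polybounded (fun x => tree_size (f x)).
Proof. by case. Qed.

Lemma polytime_id : polytime id.
Proof.
split; first exact: polybounded_size.
exists (fun r => Assign r (Var r)), (fun x => 1 + tree_size x); split.
  by polybound.
move=> r s; have := @run_assign r (Var r) s; rewrite /= addn0; apply.
by split=> [i lir|]; rewrite ?upd_eq ?upd_neq // neq_ltn lir.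
Qed.

(** The time of [g] is measured on [f x]; the size bound contained in [polytime f] turns it into a
    bound in the size of [x]. *)
Lemma polytime_comp g f : polytime g -> polytime f -> polytime (fun x => g (f x)).
Proof.
move=> [bg [Pg [Tg [bTg runP]]]] [bf [Pf [Tf [bTf runf]]]].
split; first exact: polybounded_comp bg bf.
exists (fun r => Seq (Pf r) (Pg r)), (fun x => Tf x + Tg (f x)); split.
  by apply: polybounded_add => //; apply: polybounded_comp.
move=> r s; apply: run_seq (runf r s) _ => s1 [low1 val1].
rewrite -val1; apply: run_weaken (runP r s1) _ _ => // s2 [low2 val2].
by split=> // i lir; rewrite low2 ?low1.
Qed.

Lemma polytime_leaf : polytime (fun=> Leaf).
Proof.
split; first exact: polybounded_const.
exists (fun r => Assign r Defs.Nil), (fun=> 2); split; first exact: polybounded_const.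
move=> r s; apply: (@run_assign r Defs.Nil s).
by split=> [i lir|]; rewrite ?upd_eq ?upd_neq // neq_ltn lir.
Qed.

Lemma size_hd x : tree_size (hd x) <= tree_size x.
Proof. by case: x => //= x y; lia. Qed.

Lemma size_tl x : tree_size (tl x) <= tree_size x.
Proof. by case: x => //= x y; lia. Qed.

Lemma polytime_unary e (u : tree -> tree) :
  (forall s a, eval s (e a) = u (eval s a)) ->
  (forall s a, eval_cost s (e a) = tree_size (u (eval s a)) + eval_cost s a) ->
  (forall x, tree_size (u x) <= tree_size x) ->
  polytime u.
Proof.
move=> evale coste sizeu; split; first exact: polybounded_le polybounded_size.
exists (fun r => Assign r (e (Var r))), (fun x => 1 + 2 * tree_size x); split.
  apply: polybounded_add; first exact: polybounded_const.
  by apply: polybounded_mul polybounded_size; apply: polybounded_const.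
move=> r s; apply: run_weaken (run_assign (Q := _) _) _ (fun s1 H => H).
  by rewrite evale; split=> [i lir|]; rewrite ?upd_eq ?upd_neq // neq_ltn lir.
by rewrite coste /=; have := sizeu (s r); lia.
Qed.

Lemma polytime_hd f : polytime f -> polytime (fun x => hd (f x)).
Proof.
by apply: polytime_comp; apply: (@polytime_unary Hd) => //; apply: size_hd.
Qed.

Lemma polytime_tl f : polytime f -> polytime (fun x => tl (f x)).
Proof.
by apply: polytime_comp; apply: (@polytime_unary Tl) => //; apply: size_tl.
Qed.

Lemma polytime_node f g :
  polytime f -> polytime g -> polytime (fun x => Node (f x) (g x)).
Proof.
move=> [bf [Pf [Tf [bTf runf]]]] [bg [Pg [Tg [bTg rung]]]].
have bfg : polybounded (fun x => tree_size (Node (f x) (g x))).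
  apply: (polybounded_le _ (polybounded_add (polybounded_const 1)
                                   (polybounded_add bf bg))).
  by move=> x /=; lia.
split=> //.
(* Subprograms overwrite their own register, so each gets a fresh copy of the argument kept in [r];
   [Pg] runs above [r.+1], where the value of [f] waits. *)
exists (fun r => Seq (Assign r.+1 (Var r)) (Seq (Pf r.+1) (Seq
  (Assign r.+2 (Var r)) (Seq (Pg r.+2)
  (Assign r (Defs.Cons (Var r.+1) (Var r.+2))))))).
exists (fun x => (1 + tree_size x) + (Tf x + ((1 + tree_size x) + (Tg x +
   (1 + (tree_size (Node (f x) (g x)) + (tree_size (f x) + tree_size (g x)))))))); split.
  by polybound.
move=> r s.
apply: run_seq.
  apply: run_weaken (run_assign (Q := fun s1 => s1 = upd s r.+1 (s r)) _) _ (fun s1 H => H) => //=.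
  by rewrite addn0.
move=> _ ->; set s1 := upd _ _ _.
have s1E : s1 r.+1 = s r by rewrite /s1 upd_eq.
apply: run_seq; first by have := runf r.+1 s1; rewrite s1E; apply.
move=> s2 [low2 val2].
have low2' i : i <= r -> s2 i = s i.
  by move=> lir; rewrite low2 // /s1 upd_neq // neq_ltn ltnS lir.
apply: run_seq.
  apply: run_weaken (run_assign (Q := fun s3 => s3 = upd s2 r.+2 (s r)) _) _ (fun s1 H => H) => //=.
    by rewrite low2'.
  by rewrite addn0 low2'.
move=> _ ->; set s3 := upd _ _ _.
have s3E : s3 r.+2 = s r by rewrite /s3 upd_eq.
apply: run_seq; first by have := rung r.+2 s3; rewrite s3E; apply.
move=> s4 [low4 val4].
apply: run_weaken (run_assign (Q := _) _) _ (fun s1 H => H) => /=.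
  rewrite val4 low4 // /s3 upd_neq ?neq_ltn ?ltnSn // val2.
  rewrite upd_eq; split=> // i lir.
  rewrite upd_neq ?neq_ltn ?lir // low4; last by lia.
  by rewrite /s3 upd_neq ?low2' //; lia.
by rewrite val4 low4 // /s3 upd_neq ?neq_ltn ?ltnSn // val2; lia.
Qed.

Lemma polytime_const t : polytime (fun=> t).
Proof. by elim: t => [|a IHa b IHb]; [apply: polytime_leaf | apply: polytime_node]. Qed.

Definition is_node (t : tree) : bool := if t is Node _ _ then true else false.

Lemma polytime_if c f g :
  polytime c -> polytime f -> polytime g ->
  polytime (fun x => if is_node (c x) then f x else g x).
Proof.
move=> [bc [Pc [Tc [bTc runc]]]] [bf [Pf [Tf [bTf runf]]]] [bg [Pg [Tg [bTg rung]]]].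
split.
  apply: (polybounded_le _ (polybounded_add bf bg)) => x.
  by case: ifP; rewrite ?leq_addr ?leq_addl.
exists (fun r => Seq (Assign r.+1 (Var r)) (Seq (Pc r.+1) (If r.+1 (Pf r) (Pg r)))).
exists (fun x => (1 + tree_size x) + (Tc x + (1 + (Tf x + Tg x)))); split.
  by polybound.
move=> r s.
apply: run_seq.
  apply: run_weaken (run_assign (Q := fun s1 => s1 = upd s r.+1 (s r)) _) _ (fun s1 H => H) => //=.
  by rewrite addn0.
move=> _ ->; set s1 := upd _ _ _.
have s1E : s1 r.+1 = s r by rewrite /s1 upd_eq.
apply: run_seq; first by have := runc r.+1 s1; rewrite s1E; apply.
move=> s2 [low2 val2].
have low2' i : i <= r -> s2 i = s i.
  by move=> lir; rewrite low2 // /s1 upd_neq // neq_ltn ltnS lir.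
have s2E := low2' r (leqnn r).
case cE: (c (s r)) val2 => [|ca cb] val2 /=.
  have [t [s3 [e3 l3 [low3 val3]]]] := rung r s2.
  exists t.+1, s3; split; [exact: ExecIfFalse | move: l3; rewrite s2E; lia |].
  by rewrite val3 s2E; split=> // i lir; rewrite low3 ?low2' // ltnW.
have [t [s3 [e3 l3 [low3 val3]]]] := runf r s2.
exists t.+1, s3; split; [by apply: ExecIfTrue; rewrite ?val2 | move: l3; rewrite s2E; lia |].
by rewrite val3 s2E; split=> // i lir; rewrite low3 ?low2' // ltnW.
Qed.

(* [dec] is a bijection, so trees and lists of trees are identified below. *)
Fixpoint dec (t : tree) : seq tree := if t is Node a b then a :: dec b else [::].

Lemma decK : cancel dec enc_seq.
Proof. by elim=> //= a _ b ->. Qed.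

Lemma encK : cancel enc_seq dec.
Proof. by elim=> //= a s ->. Qed.

Lemma size_enc_seq (s : seq tree) :
  tree_size (enc_seq s) = (\sum_(e <- s) (tree_size e).+1).+1.
Proof.
by elim: s => [|a s IH]; rewrite ?big_nil ?big_cons //= IH addSn addnS.
Qed.

Lemma size_dec t : size (dec t) < tree_size t.
Proof. by elim: t => //= a _ b; have := tree_size_gt0 a; lia. Qed.

(** A [While] loop over the list. Iterating a polynomial-time step can produce values of exponential
    size, hence the bound on all intermediate accumulators. *)
Lemma polytime_foldl_bounded (g : tree -> tree -> tree -> tree) l a B :
  polytime (fun z => g (hd z) (hd (tl z)) (tl (tl z))) ->
  polytime l -> polytime a -> polybounded B ->
  (forall x i, tree_size (foldl (fun y e => g x e y) (a x) (take i (dec (l x)))) <= B x) ->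
  polytime (fun x => foldl (fun y e => g x e y) (a x) (dec (l x))).
Proof.
move=> [_ [Pg [Tg [[c [k bTg]] rung]]]] [bl [Pl [Tm [bTm runl]]]] [ba [Pa [Ta [bTa runa]]]] bB leB.
set f := fun x => _.
have leB' x : tree_size (f x) <= B x by have := leB x (size (dec (l x))); rewrite take_size.
split; first exact: polybounded_le bB.
(* Register [r] keeps [x], [r.+1] the rest of the list and [r.+2] the accumulator; [r.+3] receives
   the packed argument of the step. *)
pose body r := Seq (Assign r.+3 (Defs.Cons (Var r) (Defs.Cons (Hd (Var r.+1)) (Var r.+2))))
  (Seq (Pg r.+3) (Seq (Assign r.+2 (Var r.+3)) (Assign r.+1 (Tl (Var r.+1))))).
exists (fun r => Seq (Assign r.+1 (Var r)) (Seq (Pl r.+1) (Seq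
  (Assign r.+2 (Var r)) (Seq (Pa r.+2) (Seq (While r.+1 (body r))
  (Assign r (Var r.+2))))))).
(* [sz x] bounds the packed argument, 2 being for its two [Node]s; in [Tb], [8 * sz x] pays for the
   three assignments around the step. *)
pose sz x := tree_size x + tree_size (l x) + B x + 2.
pose Tb x := c * sz x ^ k + 8 * sz x.
exists (fun x => (1 + tree_size x) + (Tm x + ((1 + tree_size x) + (Ta x +
   ((1 + tree_size (l x) * (1 + Tb x)) + (1 + B x)))))); split.
  by rewrite /Tb /sz; polybound.
move=> r s; set x := s r.
apply: run_seq.
  apply: run_weaken (run_assign (Q := fun s1 => s1 = upd s r.+1 x) _) _ (fun s1 H => H) => //=.
  by rewrite addn0.
move=> _ ->; set s1 := upd _ _ _.
have s1E : s1 r.+1 = x by rewrite /s1 upd_eq.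
apply: run_seq; first by have := runl r.+1 s1; rewrite s1E; apply.
move=> s2 [low2 val2].
have low2' i : i <= r -> s2 i = s i.
  by move=> lir; rewrite low2 // /s1 upd_neq // neq_ltn ltnS lir.
apply: run_seq.
  apply: run_weaken (run_assign (Q := fun s3 => s3 = upd s2 r.+2 x) _) _ (fun s1 H => H) => //=.
    by rewrite low2'.
  by rewrite addn0 low2'.
move=> _ ->; set s3 := upd _ _ _.
have s3E : s3 r.+2 = x by rewrite /s3 upd_eq.
apply: run_seq; first by have := runa r.+2 s3; rewrite s3E; apply.
move=> s4 [low4 val4].
have low4' i : i <= r -> s4 i = s i.
  move=> lir; rewrite low4 ?ltnS ?(ltnW lir) ?(leq_trans lir) //.
  by rewrite /s3 upd_neq ?low2' // neq_ltn ltnS (leq_trans lir).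
have val4' : s4 r.+1 = l x.
  by rewrite low4 // /s3 upd_neq ?neq_ltn ?ltnSn // val2.
pose Inv j (s' : store) := [/\ forall i, i <= r -> s' i = s i,
  dec (s' r.+1) = drop j (dec (l x)), tree_size (s' r.+1) <= tree_size (l x) &
  s' r.+2 = foldl (fun y e => g x e y) (a x) (take j (dec (l x)))].
have loop m : forall j s', j + m = size (dec (l x)) -> Inv j s' ->
    run (While r.+1 (body r)) s' (m * (Tb x).+1).+1
      (fun s'' => (forall i, i <= r -> s'' i = s i) /\ s'' r.+2 = f x).
  elim: m => [|m IH] j s' eqm [low lst szl acc].
    rewrite addn0 in eqm.
    exists 1, s'; split=> //.
      apply: ExecWhileFalse; move: lst; rewrite eqm drop_size.
      by case: (s' r.+1).
    by split=> //; rewrite acc eqm take_size.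
  have ltj : j < size (dec (l x)) by rewrite -eqm addnS ltnS leq_addr.
  have sne : s' r.+1 <> Leaf.
    by move=> E; move: lst; rewrite E /= (drop_nth Leaf ltj).
  have hdE : hd (s' r.+1) = nth Leaf (dec (l x)) j.
    by move: lst; rewrite (drop_nth Leaf ltj); case: (s' r.+1) => //= ? ? [].
  have tlE : dec (tl (s' r.+1)) = drop j.+1 (dec (l x)).
    by move: lst; rewrite (drop_nth Leaf ltj); case: (s' r.+1) => //= ? ? [].
  have accB : tree_size (s' r.+2) <= B x by rewrite acc.
  have hdB := leq_trans (size_hd (s' r.+1)) szl.
  have tlB := leq_trans (size_tl (s' r.+1)) szl.
  have s'r : s' r = x by apply: low.
  have [t1 [s1' [e1 l1 inv1]]] : run (body r) s' (Tb x) (Inv j.+1).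
    pose z := Node x (Node (hd (s' r.+1)) (s' r.+2)).
    have szz : tree_size z <= sz x by rewrite /sz /=; lia.
    pose y := g x (hd (s' r.+1)) (s' r.+2).
    have yE : y = foldl (fun y e => g x e y) (a x) (take j.+1 (dec (l x))).
      by rewrite (take_nth Leaf ltj) -cats1 foldl_cat /= -acc -hdE.
    have yB : tree_size y <= B x by rewrite yE.
    apply: (@run_weaken _ _ ((6 * sz x).+1 + (c * sz x ^ k +
      ((B x).+1 + (2 * tree_size (l x)).+1))) _ (Inv j.+1)) => //; last first.
      by rewrite /Tb /sz; lia.
    apply: run_seq.
      apply: run_weaken (run_assign (Q := fun s3 => s3 = upd s' r.+3 z) _) _ (fun s1 H => H) => //=.
        by rewrite s'r.
      by rewrite s'r; move: szz; rewrite /= /sz; lia.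
    move=> _ ->; set u1 := upd _ _ _.
    apply: run_seq.
      apply: run_weaken (rung r.+3 u1) _ (fun s1 H => H).
      rewrite /u1 upd_eq; apply: leq_trans (bTg _) _.
      by rewrite leq_mul2l leq_wexp2r ?orbT.
    move=> u2 [lowu valu].
    have u2E : u2 r.+3 = y by rewrite valu /u1 upd_eq.
    have lowu' i : i <= r.+2 -> u2 i = s' i.
      by move=> lir; rewrite lowu // /u1 upd_neq // neq_ltn ltnS lir.
    apply: run_seq.
      apply: run_weaken (run_assign (Q := fun s3 => s3 = upd u2 r.+2 y) _) _ (fun s1 H => H) => //=.
        by rewrite u2E.
      by rewrite addn0 u2E.
    move=> _ ->; set u3 := upd _ _ _.
    have u3E : u3 r.+1 = s' r.+1 by rewrite /u3 upd_neq ?neq_ltn ?ltnSn // lowu'.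
    apply: run_weaken (run_assign (Q := Inv j.+1) _) _ (fun s1 H => H) => /=.
      rewrite u3E; split.
      - by move=> i lir; rewrite /u3 !upd_neq ?lowu' ?low //; lia.
      - by rewrite upd_eq.
      - by rewrite upd_eq.
      - by rewrite upd_neq ?neq_ltn ?ltnSn ?orbT // /u3 upd_eq.
    by rewrite u3E addn0; lia.
  have [t2 [s2' [e2 l2 post]]] := IH j.+1 s1' (etrans (addSnnS _ _) eqm) inv1.
  exists (t1 + t2).+1, s2'; split=> //; first exact: ExecWhileTrue e1 e2.
  by rewrite mulSn; lia.
apply: run_seq.
  apply: run_weaken (loop (size (dec (l x))) 0 s4 _ _) _ (fun s1 H => H) => //.
    by split; rewrite ?drop0 ?take0 ?val4' // val4 /s3 upd_eq.
  by rewrite ltnS leq_mul2r ltnW ?size_dec ?orbT.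
move=> s5 [low5 val5].
apply: run_weaken (run_assign (Q := _) _) _ (fun s1 H => H) => /=.
  rewrite val5 upd_eq; split=> // i lir.
  by rewrite upd_neq ?neq_ltn ?lir // low5 // ltnW.
by rewrite addn0 val5 ltnS.
Qed.

(** Here the growth per step is bounded independently of the accumulator, so it only adds up over
    the list and stays polynomial. *)
Lemma polytime_foldl (g : tree -> tree -> tree -> tree) l a B :
  polytime (fun z => g (hd z) (hd (tl z)) (tl (tl z))) ->
  polytime l -> polytime a -> polybounded B ->
  (forall x e y, tree_size (g x e y) <= tree_size y + B (Node x e)) ->
  polytime (fun x => foldl (fun y e => g x e y) (a x) (dec (l x))).
Proof.
move=> gP lP aP [c [k leB]] growth.
pose C x := c * (1 + tree_size x + tree_size (l x)) ^ k.
apply: (@polytime_foldl_bounded g l a (fun x => tree_size (a x) + tree_size (l x) * C x)) => //.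
  by move: (polytime_size lP) (polytime_size aP) => lS aS; rewrite /C; polybound.
move=> x i.
have prefix s y : tree_size (enc_seq s) <= tree_size (l x) ->
    tree_size (foldl (fun y e => g x e y) y s) <= tree_size y + size s * C x.
  elim: s y => [|e s IH] y /= les; first by rewrite addn0.
  apply: leq_trans (IH _ _) _; first by lia.
  rewrite mulSn addnA leq_add2r; apply: leq_trans (growth _ _ _) _.
  rewrite leq_add2l; apply: leq_trans (leB _) _; rewrite leq_mul2l leq_wexp2r ?orbT //=.
  by lia.
apply: leq_trans (prefix _ _ _) _.
  rewrite -{2}(decK (l x)) !size_enc_seq ltnS.
  by rewrite -{2}(cat_take_drop i (dec (l x))) big_cat leq_addr.
rewrite leq_add2l leq_mul2r size_take_min.
by have := size_dec (l x); lia.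
Qed.

(** * Booleans and lists in polynomial time *)

Lemma polytime_is_node f : polytime f -> polytime (fun x => enc_bool (is_node (f x))).
Proof.
move=> fP; apply: (polytime_ext _ (polytime_if fP (polytime_const (enc_bool true)) polytime_leaf)).
by move=> x; case: is_node.
Qed.

Lemma is_node_bool b : is_node (enc_bool b) = b.
Proof. by case: b. Qed.

Lemma polytime_ifb (c : tree -> bool) f g :
  polytime (fun x => enc_bool (c x)) -> polytime f -> polytime g ->
  polytime (fun x => if c x then f x else g x).
Proof.
move=> cP fP gP; apply: (polytime_ext _ (polytime_if cP fP gP)) => x.
by rewrite is_node_bool.
Qed.

Lemma polytime_neg p :
  polytime (fun x => enc_bool (p x)) -> polytime (fun x => enc_bool (~~ p x)).
Proof.
move=> pP; apply: (polytime_ext _ (polytime_ifb pP polytime_leaf (polytime_const (enc_bool true)))).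
by move=> x; case: (p x).
Qed.

Lemma polytime_and p q :
  polytime (fun x => enc_bool (p x)) -> polytime (fun x => enc_bool (q x)) ->
  polytime (fun x => enc_bool (p x && q x)).
Proof.
move=> pP qP; apply: (polytime_ext _ (polytime_ifb pP qP polytime_leaf)).
by move=> x; case: (p x).
Qed.

Lemma polytime_or p q :
  polytime (fun x => enc_bool (p x)) -> polytime (fun x => enc_bool (q x)) ->
  polytime (fun x => enc_bool (p x || q x)).
Proof.
move=> pP qP; apply: (polytime_ext _ (polytime_ifb pP (polytime_const (enc_bool true)) qP)).
by move=> x; case: (p x).
Qed.

(** A left fold with [Node] pushes one list, reversed, onto another; doing so twice restores the
    order. *)
Lemma polytime_cat f g :
  polytime f -> polytime g ->
  polytime (fun x => enc_seq (dec (f x) ++ dec (g x))).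
Proof.
have catrevP u v : polytime u -> polytime v ->
    polytime (fun x => enc_seq (catrev (dec (u x)) (dec (v x)))).
  move=> uP vP.
  apply: (polytime_ext _ (@polytime_foldl (fun _ e y => Node e y) u v
    (fun z => 1 + tree_size z) _ uP vP _ _)).
  - by move=> x; elim: (dec (u x)) (v x) => [|a s IH] y /=; rewrite ?decK // IH.
  - by apply: polytime_node; do ?apply: polytime_tl; do ?apply: polytime_hd;
       do ?apply: polytime_tl; apply: polytime_id.
  - by polybound.
  - by move=> x e y /=; lia.
move=> fP gP.
apply: (polytime_ext _ (catrevP _ _ (catrevP _ _ fP polytime_leaf) gP)) => x.
by rewrite encK /= !catrevE cats0 revK.
Qed.

Lemma polytime_filter_map (p : tree -> tree -> bool) (h : tree -> tree -> tree) l :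
  polytime (fun z => enc_bool (p (hd z) (tl z))) ->
  polytime (fun z => h (hd z) (tl z)) -> polytime l ->
  polytime (fun x => enc_seq [seq h x e | e <- dec (l x) & p x e]).
Proof.
move=> pP hP lP.
have envP : polytime (fun z => Node (hd z) (hd (tl z))).
  by apply: polytime_node; do ?apply: polytime_hd; do ?apply: polytime_tl; apply: polytime_id.
have := @polytime_foldl
  (fun x e y => if p x e then enc_seq (dec y ++ [:: h x e]) else y) l
  (fun=> Leaf) (fun z => 1 + tree_size (h (hd z) (tl z))) _ lP polytime_leaf _ _.
move=> foldP; apply: polytime_ext (foldP _ _ _).
- move=> x; have gen s y : foldl (fun y e =>
      if p x e then enc_seq (dec y ++ [:: h x e]) else y) (enc_seq y) s =
      enc_seq (y ++ [seq h x e | e <- s & p x e]).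
    elim: s y => [|e s IH] y /=; first by rewrite cats0.
    by case: (p x e); rewrite ?encK IH //= -catA.
  exact: (gen _ [::]).
- apply: polytime_ifb (polytime_comp pP envP) _ _; last first.
    by do 2!apply: polytime_tl; apply: polytime_id.
  apply: (polytime_ext (f := fun z => enc_seq (dec (tl (tl z)) ++
    dec (Node (h (hd z) (hd (tl z))) Leaf)))) => //.
  apply: polytime_cat; first by do 2!apply: polytime_tl; apply: polytime_id.
  by apply: polytime_node polytime_leaf; apply: (polytime_comp hP envP).
- by have hS := polytime_size hP; polybound.
- move=> x e y /=; case: ifP => _; last by rewrite leq_addr.
  rewrite size_enc_seq big_cat big_seq1 -addSn -size_enc_seq decK; lia.
Qed.

Lemma polytime_filter (p : tree -> tree -> bool) l :
  polytime (fun z => enc_bool (p (hd z) (tl z))) -> polytime l ->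
  polytime (fun x => enc_seq [seq e <- dec (l x) | p x e]).
Proof.
move=> pP lP; have := @polytime_filter_map p (fun _ e => e) l pP (polytime_tl polytime_id) lP.
by apply: polytime_ext => x; rewrite map_id.
Qed.

Lemma polytime_map (h : tree -> tree -> tree) l :
  polytime (fun z => h (hd z) (tl z)) -> polytime l ->
  polytime (fun x => enc_seq [seq h x e | e <- dec (l x)]).
Proof.
move=> hP lP; have := @polytime_filter_map (fun _ _ => true) h l (polytime_const _) hP lP.
by apply: polytime_ext => x; rewrite filter_predT.
Qed.

Lemma polytime_has (p : tree -> tree -> bool) l :
  polytime (fun z => enc_bool (p (hd z) (tl z))) -> polytime l ->
  polytime (fun x => enc_bool (has (p x) (dec (l x)))).
Proof.
move=> pP lP; have := polytime_is_node (polytime_filter pP lP).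
by apply: polytime_ext => x; rewrite has_count -size_filter; case: filter.
Qed.

Lemma polytime_allpairs f g :
  polytime f -> polytime g ->
  polytime (fun x => enc_seq [seq Node a b | a <- dec (f x), b <- dec (g x)]).
Proof.
move=> fP gP.
have hdP := polytime_hd polytime_id; have tlP := polytime_tl polytime_id.
have rowP : polytime (fun z => enc_seq [seq Node (tl z) b | b <- dec (g (hd z))]).
  apply: (polytime_map (h := fun x b => Node (tl x) b)).
    by apply: (polytime_node _ tlP); apply: (polytime_comp tlP hdP).
  exact: polytime_comp gP hdP.
have := @polytime_foldl (fun x e y => enc_seq (dec y ++
  dec (enc_seq [seq Node (tl (Node x e)) b | b <- dec (g (hd (Node x e)))]))) f
  (fun=> Leaf) (fun z => tree_size (enc_seq [seq Node (tl z) b | b <- dec (g (hd z))]))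
  _ fP polytime_leaf (polytime_size rowP) _.
move=> foldP; apply: polytime_ext (foldP _ _).
- move=> x; have gen s y : foldl (fun y e => enc_seq (dec y ++
      dec (enc_seq [seq Node e b | b <- dec (g x)]))) (enc_seq y) s =
      enc_seq (y ++ [seq Node a b | a <- s, b <- dec (g x)]).
    elim: s y => [|e s IH] y /=; first by rewrite cats0.
    by rewrite !encK IH -catA.
  exact: (gen _ [::]).
- apply: polytime_cat; first exact: (polytime_comp tlP tlP).
  apply: (polytime_comp rowP (f := fun z => Node (hd z) (hd (tl z)))).
  by apply: polytime_node; [exact: hdP | exact: (polytime_comp hdP tlP)].
- move=> x e y /=; rewrite encK !size_enc_seq big_cat /= -addSn -size_enc_seq decK; lia.
Qed.

(** Numbers are represented by lengths of lists; comparison and indexing reduce to this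
    operation. *)
Lemma polytime_drop f g :
  polytime f -> polytime g ->
  polytime (fun x => enc_seq (drop (size (dec (f x))) (dec (g x)))).
Proof.
move=> fP gP.
apply: (polytime_ext _ (@polytime_foldl (fun _ _ y => tl y) f g (fun=> 0) _ fP gP _ _)).
- move=> x; rewrite -[LHS]decK; congr enc_seq.
  elim: (dec (f x)) (g x) => [|a s IH] y /=; first by rewrite drop0.
  by rewrite IH; case: y.
- by do 3!apply: polytime_tl; apply: polytime_id.
- exact: polybounded_const.
- by move=> x e y; rewrite addn0 size_tl.
Qed.

Lemma polytime_ltn_size f g :
  polytime f -> polytime g ->
  polytime (fun x => enc_bool (size (dec (f x)) < size (dec (g x)))).
Proof.
move=> fP gP; apply: (polytime_ext _ (polytime_is_node (polytime_drop fP gP))) => x.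
by rewrite -subn_gt0 -size_drop; case: drop.
Qed.

Lemma polytime_nth f g :
  polytime f -> polytime g ->
  polytime (fun x => nth Leaf (dec (g x)) (size (dec (f x)))).
Proof.
move=> fP gP; apply: (polytime_ext _ (polytime_hd (polytime_drop fP gP))) => x.
by rewrite -[in RHS](addn0 (size _)) -nth_drop; case: drop.
Qed.

(** * Greedy choice and local search *)

Section Algorithm.

Variables (A : Type) (c : rel A) (f : nat).
Implicit Types (M E U : seq A) (e : A).

Definition unblocked M e : bool := ~~ has (c e) M.

Definition greedy_step E M e :=
  if unblocked M e && (size [seq e' <- E | unblocked M e' && c e e'] <= f)
  then e :: M else M.

(* The pair (e1, e2) stands for the single insertion of e1 when its members
   conflict, in particular when e1 = e2. *)
Definition exchange M e1 e2 :=
  e1 :: (if c e1 e2 then [seq e <- M | ~~ c e1 e]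
         else e2 :: [seq e <- M | ~~ c e1 e && ~~ c e2 e]).

Definition exchange_step M (p : A * A) :=
  if size M < size (exchange M p.1 p.2) then exchange M p.1 p.2 else M.

(** The number of sweeps over [s] is fixed in advance as the length of [E], an upper bound for the
    length of the solutions. *)
Definition passes (B : Type) (step : seq A -> B -> seq A) E (s : seq B) :=
  foldl step [::] (flatten [seq s | _ <- E]).

Definition greedy E := passes (greedy_step E) E E.

Definition local_search U :=
  passes exchange_step U [seq (a, b) | a <- U, b <- U].

Definition approx_independent E :=
  local_search [seq e <- E | unblocked (greedy E) e] ++ greedy E.

End Algorithm.

(** * Sweeps reach a fixed point *)

Section Passes.

Variables (A : Type) (B : eqType) (step : seq A -> B -> seq A).
Variables (E : seq A) (s : seq B) (P : seq A -> Prop).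
Hypothesis P_step : forall M b, b \in s -> P M -> P (step M b).
Hypothesis step_grows : forall M b, step M b = M \/ size M < size (step M b).

Lemma foldl_step_fixed M s' :
  (forall b, b \in s' -> step M b = M) -> foldl step M s' = M.
Proof.
elim: s' => //= b s' IH fixM.
by rewrite fixM ?mem_head // IH // => b' b's; rewrite fixM // inE b's orbT.
Qed.

Lemma pass_inv M s' : {subset s' <= s} -> P M ->
  P (foldl step M s') /\
  (size M < size (foldl step M s') \/ forall b, b \in s' -> step M b = M).
Proof.
elim: s' M => [|b s' IH] M sub PM /=; first by split=> //; right.
have bs : b \in s by rewrite sub ?mem_head.
have sub' : {subset s' <= s} by move=> b' b's; rewrite sub // inE b's orbT.
have [Pf grow] := IH _ sub' (P_step bs PM).
split=> //; case: (step_grows M b) => [eqM|lt]; last first.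
  left; case: grow => [|fixM]; first exact: ltn_trans.
  by rewrite foldl_step_fixed.
rewrite eqM in grow *; case: grow; [by left | move=> fixM; right=> b'].
by rewrite inE => /predU1P[->|/fixM].
Qed.

Hypothesis P_bound : forall M, P M -> size M <= size E.
Hypothesis P_nil : P [::].

(** A sweep that does not lengthen the list leaves it fixed under all steps. If all [size E] sweeps
    lengthen it, the length bound is attained and no further step can change the list. *)
Lemma passes_inv : P (passes step E s) /\
  forall b, b \in s -> step (passes step E s) b = passes step E s.
Proof.
rewrite /passes.
have gen (E' : seq A) M : P M -> let M' := foldl step M (flatten [seq s | _ <- E']) in
    P M' /\ (size E' + size M <= size M' \/ forall b, b \in s -> step M' b = M').
  elim: E' M => [|a E' IH] M PM /=; first by split=> //; left.
  rewrite foldl_cat.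
  have [PM' [lt|fixM]] := @pass_inv M s (fun x xs => xs) PM.
    have [Pr grow] := IH _ PM'; split=> //; case: grow => [le|]; [left | by right].
    by apply: leq_trans le; rewrite addSn -addnS leq_add2l.
  rewrite (foldl_step_fixed fixM).
  suff -> : foldl step M (flatten [seq s | _ <- E']) = M by split=> //; right.
  by elim: E' {IH} => //= _ E' IH; rewrite foldl_cat (foldl_step_fixed fixM).
have [PM size_or_fixed] := gen E [::] P_nil; rewrite addn0 in size_or_fixed.
split=> // b bs; case: size_or_fixed => [le|]; last exact.
case: (step_grows (foldl step [::] (flatten [seq s | _ <- E])) b) => // lt.
by have := leq_trans lt (P_bound (P_step bs PM)); rewrite ltnNge le.
Qed.

End Passes.

(** * Guarantees for an abstract conflict relation *)

Section AlgorithmSpec.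

Variables (A : eqType) (c : rel A) (K : nat).
Implicit Types (M E U : seq A) (e : A).

Hypothesis c_sym : symmetric c.

Definition independent M := pairwise (fun e e' => ~~ c e e') M.

Lemma unblockedE M e : unblocked c M e = all (fun e' => ~~ c e e') M.
Proof. by rewrite /unblocked -all_predC. Qed.

(** Elements of [E] conflict with themselves, so an independent list cannot repeat one. *)
Lemma independent_size M E :
  {in E, forall e, c e e} -> {subset M <= E} -> independent M ->
  uniq M /\ size M <= size E.
Proof.
move=> c_refl subM ind; suff uM : uniq M by split=> //; apply: uniq_leq_size.
elim: M subM ind => //= e M IH subM /andP[/allP eM ind].
rewrite IH // ?andbT => [|e' e'M]; last by rewrite subM // inE e'M orbT.
apply/negP => /eM /negP; apply; apply: c_refl.
by apply: subM; rewrite mem_head.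
Qed.

(** Each insertion newly blocks at most [K %/ 6] elements, and these counts add up over [M]; at the
    fixed point no unblocked element passes the greedy test. *)
Lemma greedy_inv E (M := greedy c (K %/ 6) E) :
  {in E, forall e, c e e} ->
  [/\ {subset M <= E}, independent M,
      6 * size [seq e <- E | ~~ unblocked c M e] <= K * size M &
      {in E, forall e, unblocked c M e ->
         K < 6 * size [seq e' <- E | unblocked c M e' && c e e']}].
Proof.
move=> c_refl.
pose P M := [/\ {subset M <= E}, independent M &
   6 * size [seq e <- E | ~~ unblocked c M e] <= K * size M].
have [||||[subM indM leM] fixM] := @passes_inv A A (greedy_step c (K %/ 6) E) E E P.
- move=> M' e eE [sub ind le]; rewrite /greedy_step; case: ifP => // /andP[fr few].
  split; first by move=> e'; rewrite inE => /predU1P[->|/sub].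
    by rewrite /independent pairwise_cons -unblockedE fr.
  have leK : 6 * size [seq e' <- E | unblocked c M' e' && c e e'] <= K.
    by rewrite mulnC -leq_divRL.
  have : size [seq e' <- E | ~~ unblocked c (e :: M') e'] <=
      size [seq e' <- E | unblocked c M' e' && c e e'] + size [seq e' <- E | ~~ unblocked c M' e'].
    rewrite !size_filter -count_predUI; apply: leq_trans (leq_addr _ _).
    apply: sub_count => e' /=.
    by rewrite /unblocked /= negbK c_sym; case: (has _ M'); rewrite ?orbT //= orbF => ->.
  by rewrite /= mulnS; lia.
- move=> M' e; rewrite /greedy_step; case: ifP => _; first by right.
  by left.
- by move=> M' [sub ind _]; have [] := independent_size c_refl sub ind.
- by split=> //; rewrite filter_pred0.
split=> // e eE fr; rewrite mulnC -ltn_divLR // ltnNge; apply/negP => few.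
have := fixM e eE; rewrite /greedy_step fr few /=.
by move/(congr1 size)/eqP; rewrite /= eqn_leq ltnn.
Qed.

Lemma local_search_inv U (M := local_search c U) :
  {in U, forall e, c e e} ->
  [/\ {subset M <= U}, independent M &
      {in U &, forall a b, size (exchange c M a b) <= size M}].
Proof.
move=> c_refl.
pose P M := {subset M <= U} /\ independent M.
have [||||[subM indM] fixM] :=
  @passes_inv A (A * A)%type (exchange_step c) U [seq (a, b) | a <- U, b <- U] P.
- move=> M' _ /allpairsP[[a b] /= [aU bU ->]] [sub ind].
  rewrite /exchange_step /=; case: ifP => // _; rewrite /exchange.
  case: ifP => [_|nab]; split.
  + move=> e; rewrite inE => /predU1P[->//|].
    by rewrite mem_filter => /andP[_ /sub].
  + rewrite /independent pairwise_cons -/(independent _) /independent pairwise_filter //.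
    by rewrite andbT; apply/allP => e; rewrite mem_filter => /andP[].
  + move=> e; rewrite !inE => /or3P[/eqP->//|/eqP->//|].
    by rewrite mem_filter => /andP[_ /sub].
  + rewrite /independent !pairwise_cons /= nab /= pairwise_filter // andbT.
    by apply/andP; split; apply/allP => e; rewrite mem_filter => /andP[/andP[]].
- by move=> M' p; rewrite /exchange_step; case: ifP; [right | left].
- by move=> M' [sub ind]; have [] := independent_size c_refl sub ind.
- by [].
split=> // a b aU bU; rewrite leqNgt; apply/negP => lt.
have := fixM (a, b) (allpairs_f _ aU bU); rewrite /exchange_step /= lt.
by move/(congr1 size) => eqs; move: lt; rewrite eqs ltnn.
Qed.

Definition private M e e' := c e e' && (count (c e') M == 1).

(** If [a] and [b] did not conflict, inserting both would delete only [e], their sole conflict in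
    [M], and so lengthen the list. *)
Lemma private_clique U M :
  {in U &, forall a b, size (exchange c M a b) <= size M} ->
  {in M, forall e, {in U &, forall a b,
     private M e a -> private M e b -> c a b}}.
Proof.
move=> opt e eM a b aU bU /andP[ea /eqP a1] /andP[eb /eqP b1].
apply: contraT => nab; have := opt a b aU bU.
rewrite /exchange (negPf nab) /= size_filter.
have := count_predC (predU (c a) (c b)) M.
have := count_predUI (c a) (c b) M; rewrite a1 b1.
have : 0 < count (predI (c a) (c b)) M.
  by rewrite -has_count; apply/hasP; exists e => //=; rewrite ![c _ e]c_sym ea eb.
rewrite (eq_count (a1 := fun e => ~~ c a e && ~~ c b e) (a2 := predC (predU (c a) (c b)))).
  by set x := count (predU _ _) _; lia.
by move=> e' /=; rewrite negb_or.
Qed.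

Lemma count_sum (T : Type) (p : pred T) s : count p s = \sum_(x <- s) p x.
Proof. by rewrite -sum1_count big_mkcond. Qed.

(** An element of [U] with two or more conflicts in [M] is counted at least twice by the first term;
    one with a single conflict is counted once by each term. *)
Lemma double_cover U M :
  {in U, forall e, c e e} ->
  {in U &, forall a b, size (exchange c M a b) <= size M} ->
  2 * size U <= \sum_(e <- M) (count (c e) U + count (private M e) U).
Proof.
move=> c_refl opt.
have countE (p : A -> pred A) :
    \sum_(e <- M) count (p e) U = \sum_(e' <- U) \sum_(e <- M) p e e'.
  by rewrite (eq_bigr _ (fun e _ => count_sum (p e) U)) exchange_big.
rewrite big_split /= !countE -big_split /=.
rewrite -sum1_size big_distrr /= !big_seq; apply: leq_sum => e eU.
have eqc : \sum_(i <- M) c i e = count (c e) M.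
  by rewrite count_sum; apply: eq_bigr => i _; rewrite c_sym.
(* Without a conflict in [M], the single insertion [exchange c M e e] would lengthen the list. *)
have pos : 0 < count (c e) M.
  have := opt e e eU eU; rewrite /exchange c_refl //= size_filter.
  have -> : count (fun x => ~~ c e x) M = count (predC (c e)) M by [].
  by have := count_predC (c e) M; lia.
rewrite eqc /private; case: eqP => [e1|]; last by lia.
by rewrite (eq_bigr (fun i => c i e : nat)) => [|i _]; rewrite ?andbT // eqc; lia.
Qed.

(** The hypothesis bounds the charge to one element found by local search; its factor 2 cancels
    against the double count, so both phases account for at most [K] / 6 elements of [E] per chosen
    one. *)
Lemma approx_independent_ratio E (M := approx_independent c (K %/ 6) E) :
  {in E, forall e, c e e} ->
  (forall M1 U e (Q : pred A), {subset M1 <= E} ->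
     U = [seq e' <- E | unblocked c M1 e'] -> e \in U ->
     {in U, forall e', K < 6 * count (c e') U} ->
     {in Q, forall e', c e e'} -> {in U &, forall a b, Q a -> Q b -> c a b} ->
     6 * (count (c e) U + count Q U) <= 2 * K) ->
  [/\ {subset M <= E}, independent M & 6 * size E <= K * size M].
Proof.
move=> c_refl bound.
have [sub1 ind1 le1 stuck] := greedy_inv c_refl.
rewrite /M /approx_independent; set M1 := greedy _ _ _ in sub1 ind1 le1 stuck *.
set U := [seq e <- E | unblocked c M1 e].
have subU : {subset U <= E} by move=> e; rewrite mem_filter => /andP[].
have c_reflU : {in U, forall e, c e e} by move=> e /subU /c_refl.
have [sub2 ind2 opt] := local_search_inv c_reflU.
set M2 := local_search c U in sub2 ind2 opt *.
split.
- by move=> e; rewrite mem_cat => /orP[/sub2/subU|/sub1].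
- rewrite /independent pairwise_cat -!/(independent _) ind1 ind2 !andbT.
  by apply/allrelP => e e1 /sub2; rewrite mem_filter unblockedE => /andP[/allP fr _] /fr.
have le2 : 6 * size U <= K * size M2.
  have le : 6 * (2 * size U) <= 2 * K * size M2.
    apply: leq_trans (leq_mul (leqnn 6) (double_cover c_reflU opt)) _.
    rewrite big_distrr /= -[size M2]sum1_size big_distrr /= !big_seq.
    apply: leq_sum => e eM2; rewrite muln1.
    apply: (bound M1 U) => //; first exact: sub2.
    - move=> e' e'U; move: (e'U); rewrite mem_filter => /andP[fr e'E].
      apply: leq_trans (stuck e' e'E fr) _.
      rewrite leq_mul2l /= count_filter size_filter.
      by apply: sub_count => x /= /andP[-> ->].
    - by move=> e' /andP[].
    - exact: private_clique opt e eM2.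
  by lia.
rewrite size_cat mulnDr; apply: leq_trans (leq_add le2 le1).
rewrite -mulnDr leq_mul2l /= /U !size_filter.
by rewrite count_predC.
Qed.

End AlgorithmSpec.

(** * Invariance under maps that preserve the relation *)

Section Naturality.

Variables (A B : Type) (cA : rel A) (cB : rel B) (k : A -> B) (f : nat).
Hypothesis cE : forall a b, cB (k a) (k b) = cA a b.

Lemma unblocked_map M e : unblocked cB (map k M) (k e) = unblocked cA M e.
Proof. by rewrite /unblocked has_map; congr (~~ _); apply: eq_has => a /=. Qed.

Lemma passes_map (CA CB : Type) (stepA : seq A -> CA -> seq A)
    (stepB : seq B -> CB -> seq B) (kc : CA -> CB) E s :
  (forall M a, stepB (map k M) (kc a) = map k (stepA M a)) ->
  passes stepB (map k E) (map kc s) = map k (passes stepA E s).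
Proof.
move=> stepE; rewrite /passes.
have -> : flatten [seq map kc s | _ <- map k E] = map kc (flatten [seq s | _ <- E]).
  by elim: E => //= _ E ->; rewrite map_cat.
rewrite -[[::] in LHS]/(map k [::]); elim: (flatten _) [::] => //= a s' IH M.
by rewrite stepE IH.
Qed.

Lemma greedy_map E : greedy cB f (map k E) = map k (greedy cA f E).
Proof.
apply: passes_map => M a; rewrite /greedy_step unblocked_map filter_map size_map.
rewrite (eq_filter (a2 := fun e => unblocked cA M e && cA a e)); first by case: ifP.
by move=> e /=; rewrite unblocked_map cE.
Qed.

Lemma exchange_map M a b : exchange cB (map k M) (k a) (k b) = map k (exchange cA M a b).
Proof.
rewrite /exchange cE !filter_map.
rewrite (eq_filter (a2 := fun e => ~~ cA a e)) => [|e /=]; last by rewrite cE.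
rewrite [X in _ :: map k X](eq_filter (a2 := fun e => ~~ cA a e && ~~ cA b e)) => [|e /=].
  by case: ifP.
by rewrite !cE.
Qed.

Lemma local_search_map U : local_search cB (map k U) = map k (local_search cA U).
Proof.
rewrite /local_search -(passes_map (kc := fun p => (k p.1, k p.2))
  (stepA := exchange_step cA) (stepB := exchange_step cB)).
  by rewrite allpairs_mapl allpairs_mapr map_allpairs.
move=> M p; rewrite /exchange_step -[(k p.1, k p.2).1]/(k p.1) -[(_, _).2]/(k p.2).
by rewrite exchange_map !size_map; case: ifP.
Qed.

(** Elements are inspected only through the relation; this carries the analysis for pairs of
    vertices over to their codes as trees. *)
Lemma approx_independent_map E :
  approx_independent cB f (map k E) = map k (approx_independent cA f E).
Proof.
rewrite /approx_independent greedy_map filter_map map_cat; congr (_ ++ _).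
rewrite -local_search_map; congr (local_search _ (map k _)).
by apply: eq_filter => e /=; rewrite unblocked_map.
Qed.

End Naturality.

(** * Cliques of the conflict relation *)

Lemma card_rel (S T : finType) (P : S -> T -> bool) :
  #|[set p : S * T | P p.1 p.2]| = \sum_x #|[set y | P x y]|.
Proof.
rewrite -sum1_card (eq_bigl (fun p => P p.1 p.2)) => [|p]; last by rewrite inE.
rewrite -(pair_big_dep predT P (fun _ _ => 1)) /=.
apply: eq_bigr => x _; rewrite -sum1_card.
by apply: eq_bigl => y; rewrite inE.
Qed.

Lemma card_rel_in (S T : finType) (A : {set S}) (P : S -> T -> bool) :
  #|[set p : S * T | (p.1 \in A) && P p.1 p.2]| = \sum_(x in A) #|[set y | P x y]|.
Proof.
rewrite (card_rel (fun x y => (x \in A) && P x y)) [RHS]big_mkcond /=.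
apply: eq_bigr => x _; case: ifP => // _.
by rewrite -[RHS](cards0 T); congr #|pred_of_set _|; apply/setP => y; rewrite !inE.
Qed.

Lemma card_swap (T : finType) (X : {set T * T}) :
  #|[set p : T * T | (p.2, p.1) \in X]| = #|X|.
Proof.
have swapK : involutive (fun p : T * T => (p.2, p.1)) by case.
rewrite -(card_imset _ (inv_inj swapK)); apply: eq_card => p.
apply/imsetP/idP => [[q]|pX]; first by rewrite inE => qX ->.
by exists (p.2, p.1); rewrite ?inE -?surjective_pairing //= -surjective_pairing.
Qed.

Section Counting.

Variables (T : finType) (h : rel T) (d : nat).
Hypothesis h_sym : symmetric h.

Definition nbr x := [set y | h x y].

Hypothesis deg_le : forall x, #|nbr x| <= d.

(** The number e(N(x), N(y)) of the overview. *)
Definition cross x y :=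
  #|[set p : T * T | (p.1 \in nbr x) && ((p.2 \in nbr y) && h p.1 p.2)]|.

Lemma cross_sum x y : cross x y = \sum_(p in nbr x) #|nbr y :&: nbr p|.
Proof.
rewrite /cross (card_rel_in (nbr x) (fun p q => (q \in nbr y) && h p q)).
by apply: eq_bigr => p _; apply: eq_card => q; rewrite !inE.
Qed.

Lemma crossC x y : cross x y = cross y x.
Proof.
rewrite /cross -card_swap; apply: eq_card => p; rewrite !inE /=.
by rewrite [h p.2 p.1]h_sym andbCA.
Qed.

Section Clique.

Variable X : {set T * T}.

Definition row a := [set b | (a, b) \in X].
Definition col b := [set a | (a, b) \in X].

Hypothesis X_edges : forall p, p \in X -> h p.1 p.2.
Hypothesis X_clique : {in X &, forall p q, h p.1 q.2 || h q.1 p.2}.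

Lemma col_sub b : col b \subset nbr b.
Proof. by apply/subsetP => a; rewrite !inE => /X_edges; rewrite h_sym. Qed.

(** If some [a] in [col b] is not adjacent to [b'], the clique condition makes every [a'] in
    [col b'] adjacent to [b]. *)
Lemma col_nested b b' : (col b \subset nbr b') || (col b' \subset nbr b).
Proof.
apply/orP; case: (boolP (col b \subset _)) => [|nsub]; [by left | right].
case/subsetPn: nsub => a; rewrite !inE => abX nab; apply/subsetP => a'.
rewrite !inE => ab'X; have := X_clique abX ab'X.
by rewrite /= ![h _ b']h_sym ![h _ b]h_sym (negPf nab).
Qed.

Lemma minn_col b b' : minn #|col b| #|col b'| <= #|nbr b :&: nbr b'|.
Proof.
rewrite geq_min; case/orP: (col_nested b b') => sub; apply/orP.
  by left; apply: subset_leq_card; rewrite subsetI col_sub.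
by right; apply: subset_leq_card; rewrite subsetI sub col_sub.
Qed.

(* With a of maximum degree s in X and K the common neighbourhood of row a, the
   edges of X that miss N(a) have an end in K, so there are at most
   |K| min(s, d - s) of them.  If |K| <= s this is at most s (d - s), and the
   edges of X that meet N(a) are counted by [cross a b] for the b in N(a) of
   maximum degree in X; otherwise the b in row a of maximum degree works. *)
Lemma clique_le_cross_row a :
  0 < #|row a| -> (forall x, #|row x| <= #|row a|) ->
  (forall x, #|col x| <= #|row a|) ->
  exists2 b, h a b & 4 * #|X| <= 4 * cross a b + d ^ 2.
Proof.
set s := #|row a| => s_gt0 row_le col_le.
have row_sub x : row x \subset nbr x.
  by apply/subsetP => y; rewrite !inE => /X_edges.
have s_le : s <= d by apply: leq_trans (deg_le a); apply: subset_leq_card.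
pose K := [set x | row a \subset nbr x]; set k := #|K|.
pose m := minn s (d - s).
have leX : #|X| <= \sum_(b in nbr a) #|col b| + k * m.
  pose X1 := [set p in X | p.2 \in nbr a]; pose X2 := X :\: X1.
  have -> : #|X| = #|X1| + #|X2|.
    by rewrite -(cardsID X1) (setIidPr _) //; apply/subsetP => p; rewrite inE => /andP[].
  apply: leq_add.
    rewrite -card_swap -(card_rel_in (nbr a) (fun b x => (x, b) \in X)) leq_eqVlt.
    by rewrite eq_sym; apply/orP; left; apply/eqP/eq_card => p; rewrite !inE andbC.
  (* For (x, y) in [X] with y outside N(a) and any b in [row a], the clique condition with (a, b)
     leaves only x ~ b, so x lies in [K]. *)
  have -> : X2 = [set p : T * T | (p.1 \in K) && (p \in X2)].
    apply/setP => p; rewrite [RHS]inE; case: (boolP (p \in X2)); rewrite ?andbF // andbT.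
    rewrite !inE => /andP[np pX]; rewrite pX /= in np; apply/esym/subsetP => b.
    rewrite !inE => abX; have := X_clique abX pX; rewrite /= (negPf np) /=.
    by [].
  rewrite (eq_card (B := [set p : T * T | (p.1 \in K) && ((p.1, p.2) \in X2)])); last first.
    by move=> p; rewrite !inE -surjective_pairing.
  rewrite (card_rel_in K (fun x b => (x, b) \in X2)) /k -sum1_card big_distrl /=.
  apply: leq_sum => x; rewrite inE mul1n => xK; rewrite leq_min; apply/andP; split.
    apply: leq_trans (row_le x); apply: subset_leq_card; apply/subsetP => b.
    by rewrite !inE => /andP[].
  (* [row a] and the row of [x] in [X2] are disjoint subsets of N(x), since the latter avoids
     N(a). *)
  rewrite -(leq_add2r s) subnK //; apply: leq_trans (deg_le x).
  rewrite addnC -cardsUI (_ : _ :&: _ = set0) ?cards0 ?addn0.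
    rewrite subset_leq_card // subUset xK /=; apply/subsetP => b.
    by rewrite !inE => /andP[_ /X_edges].
  apply/setP => b; rewrite !inE; apply/negP => /and3P[/X_edges /= hab nxb xbX].
  by rewrite xbX hab in nxb.
have sd : 4 * (s * (d - s)) <= d ^ 2 by nia.
have row_pos : exists b, b \in row a by apply/set0Pn; rewrite -card_gt0.
have [b0 b0a] := row_pos.
have row_nbr x : x \in row a -> h a x by move/(subsetP (row_sub a)); rewrite inE.
have [k_le|k_gt] := leqP k s.
  have b0N : b0 \in nbr a by apply: (subsetP (row_sub a)).
  case: (arg_maxnP (fun b => #|col b|) b0N) => b bN bmax.
  exists b; first by have : b \in nbr a by []; rewrite inE.
  (* As [col b] is a largest column over N(a), the minimum in [minn_col] is always the size of the
     other column. *)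
  have : \sum_(x in nbr a) #|col x| <= cross a b.
    rewrite cross_sum; apply: leq_sum => x xN; apply: leq_trans (minn_col b x).
    by rewrite leq_min leqnn andbT; apply: bmax.
  by rewrite /m in leX; nia.
case: (arg_maxnP (fun b => #|col b|) b0a) => b bR bmax.
exists b; first exact: row_nbr.
set t := #|col b| in bmax.
have t_le : t <= s by apply: col_le.
pose mu := \sum_(x in nbr a :\: row a) minn t #|col x|.
have splitN (F : T -> nat) : \sum_(x in nbr a) F x =
    \sum_(x in row a) F x + \sum_(x in nbr a :\: row a) F x.
  rewrite (big_setID (row a)) /=; congr (_ + _); apply: eq_bigl => x.
  by rewrite (setIidPr (row_sub a)).
(* Each vertex of [row a] shares all of [K] with [b] as neighbours; the rest of N(a) contributes
   through [minn_col]. *)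
have le_cross : s * k + mu <= cross a b.
  rewrite cross_sum splitN; apply: leq_add.
    rewrite /s -sum1_card big_distrl /=; apply: leq_sum => x xR; rewrite mul1n.
    apply: subset_leq_card; apply/subsetP => y; rewrite !inE => /subsetP yK.
    by have := yK _ xR; have := yK _ bR; rewrite !inE ![h y _]h_sym => -> ->.
  by apply: leq_sum => x _; apply: minn_col.
(* Passing from the minimum with [t] to the full column costs at most [s - t] for each of the at
   most [d - s] vertices outside [row a]. *)
have le_sum : \sum_(x in nbr a) #|col x| <= s * t + (mu + (d - s) * (s - t)).
  rewrite splitN; apply: leq_add.
    rewrite /s -sum1_card big_distrl /=; apply: leq_sum => x xR; rewrite mul1n.
    exact: bmax.
  apply: (@leq_trans (\sum_(x in nbr a :\: row a) (minn t #|col x| + (s - t)))).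
    by apply: leq_sum => x _; have := col_le x; lia.
  rewrite big_split /= leq_add2l sum_nat_const leq_mul2r; apply/orP; right.
  have := cardsID (row a) (nbr a); rewrite (setIidPr (row_sub a)) -/s.
  by have := deg_le a; lia.
(* What remains is [t * s <= t * (d - s)] if [s < d - s], and otherwise
   [t * (2 * s - d) <= k * (2 * s - d)], which holds as [t <= s < k]. *)
rewrite /m in leX; move: leX; rewrite /minn; case: ifP => cmp leX.
  suff : s * t + (d - s) * (s - t) + k * s <= s * k + s * (d - s) by lia.
  by nia.
suff : s * t + (d - s) * (s - t) + k * (d - s) <= s * k + s * (d - s) by lia.
by nia.
Qed.

End Clique.

(** The vertex [a] maximises the degree in [X] over both sides; if a column attains the maximum, [X]
    is transposed. *)
Lemma clique_le_cross (X : {set T * T}) :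
  X != set0 -> (forall p, p \in X -> h p.1 p.2) ->
  {in X &, forall p q, h p.1 q.2 || h q.1 p.2} ->
  exists x y, h x y /\ 4 * #|X| <= 4 * cross x y + d ^ 2.
Proof.
case/set0Pn => -[a0 b0] p0X X_edges X_clique.
pose deg v := maxn #|row X v| #|col X v|.
case: (@arg_maxnP _ a0 xpredT deg isT) => a _ amax.
have deg_pos : 0 < deg a.
  apply: leq_trans (amax a0 isT); rewrite leq_max card_gt0.
  by apply/orP; left; apply/set0Pn; exists b0; rewrite inE.
have row_le x : #|row X x| <= deg a by apply: leq_trans (amax x isT); rewrite leq_maxl.
have col_le x : #|col X x| <= deg a by apply: leq_trans (amax x isT); rewrite leq_maxr.
have [ge|lt] := leqP #|col X a| #|row X a|.
  have degE : deg a = #|row X a| by apply/maxn_idPl.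
  rewrite degE in row_le col_le deg_pos.
  have [b hab le] := clique_le_cross_row X_edges X_clique deg_pos row_le col_le.
  by exists a, b.
have degE : deg a = #|col X a| by apply/maxn_idPr/ltnW.
pose Y := [set p : T * T | (p.2, p.1) \in X].
have rowY x : row Y x = col X x by apply/setP => y; rewrite !inE.
have colY x : col Y x = row X x by apply/setP => y; rewrite !inE.
have [||||| b hab le] := @clique_le_cross_row Y _ _ a.
- by move=> p; rewrite inE => /X_edges; rewrite h_sym.
- move=> p q; rewrite !inE => pX qX; have := X_clique _ _ pX qX.
  by rewrite /= orbC ![h p.2 _]h_sym ![h q.2 _]h_sym.
- by rewrite rowY -degE.
- by move=> x; rewrite !rowY -degE.
- by move=> x; rewrite rowY colY -degE.
by exists a, b; rewrite -(card_swap X).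
Qed.

(** Arcs sharing an end conflict too, as the other end of one is adjacent to the shared end; so an
    arc conflicts with itself and with its reversal. *)
Definition conflict (p q : T * T) :=
  [|| h p.1 q.1, h p.1 q.2, h p.2 q.1 | h p.2 q.2].

Definition arcs := [set p : T * T | h p.1 p.2].

(** * Conflicts without closed walks of length 3 and 5 *)

Hypothesis no_triangle : forall x y z, h x y -> h y z -> h z x -> False.

(** A conflicting arc starts ([A1]) or ends ([A2]) in the union of N(x) and N(y), with at most 2 d^2
    arcs of each kind. Arcs between N(x) and N(y), which are disjoint for lack of triangles, are of
    both kinds. *)
Lemma conflict_cross x y :
  h x y -> #|[set p in arcs | conflict (x, y) p]| + 2 * cross x y <= 4 * d ^ 2.
Proof.
move=> hxy; pose N := nbr x :|: nbr y.
have disj z : ~~ ((z \in nbr x) && (z \in nbr y)).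
  by rewrite !inE; apply/negP => /andP[hxz]; rewrite h_sym => hzy;
    apply: (no_triangle hxz hzy); rewrite h_sym.
pose A1 := [set p : T * T | (p.1 \in N) && h p.1 p.2].
pose A2 := [set p : T * T | (p.2, p.1) \in A1].
have cardN : #|N| <= 2 * d.
  by rewrite cardsU; have := deg_le x; have := deg_le y; lia.
have card1 : #|A1| <= 2 * d ^ 2.
  rewrite (card_rel_in N h); apply: (@leq_trans (\sum_(z in N) d)).
    by apply: leq_sum => z _; apply: deg_le.
  by rewrite sum_nat_const; nia.
have card2 : #|A2| <= 2 * d ^ 2 by rewrite card_swap.
have subU : [set p in arcs | conflict (x, y) p] \subset A1 :|: A2.
  apply/subsetP => p; rewrite !inE /= [h p.2 p.1]h_sym => /andP[-> ].
  by case/or4P => ->; rewrite ?orbT.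
pose C1 := [set p : T * T | (p.1 \in nbr x) && ((p.2 \in nbr y) && h p.1 p.2)].
pose C2 := [set p : T * T | (p.1 \in nbr y) && ((p.2 \in nbr x) && h p.1 p.2)].
have subI : C1 :|: C2 \subset A1 :&: A2.
  apply/subsetP => p; rewrite !inE /= [h p.2 p.1]h_sym.
  by case/orP => /and3P[-> -> ->]; rewrite ?orbT.
have cardC : #|C1 :|: C2| = 2 * cross x y.
  rewrite cardsU (_ : C1 :&: C2 = set0) ?cards0 ?subn0.
    by rewrite -[#|C1|]/(cross x y) -[#|C2|]/(cross y x) (crossC y x) mul2n addnn.
  apply/setP => p; rewrite !inE; apply/negP => /andP[/and3P[px _ _] /and3P[py _ _]].
  by have := disj p.1; rewrite !inE px py.
have := cardsUI A1 A2; have := subset_leq_card subU; have := subset_leq_card subI.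
by rewrite cardC; lia.
Qed.

Hypothesis no_walk5 : forall x1 x2 x3 x4 x5,
  h x1 x2 -> h x2 x3 -> h x3 x4 -> h x4 x5 -> h x5 x1 -> False.

Hypothesis conflict_gt : forall x y, h x y ->
  17 * d ^ 2 < 6 * #|[set p in arcs | conflict (x, y) p]|.

Definition sphere2 u := [set x | [exists w, h u w && h w x]].

(** An edge between the ends of two walks of length 2 from [u] would complete a closed walk of
    length 5. *)
Lemma sphere2_indep u x y : x \in sphere2 u -> y \in sphere2 u -> ~~ h x y.
Proof.
rewrite !inE => /existsP[w /andP[huw hwx]] /existsP[w' /andP[huw' hwy]].
apply/negP => hxy; apply: (no_walk5 huw hwx hxy (x5 := w')).
  by rewrite h_sym.
by rewrite h_sym.
Qed.

Lemma clique_half u v (S : {set T * T}) :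
  {subset S <= arcs} -> {in S &, forall p q, conflict p q} ->
  {in S, forall p, (p.1 \in sphere2 u) && (p.2 \in sphere2 v)} ->
  12 * #|S| <= 10 * d ^ 2.
Proof.
move=> S_edges S_clique S_side.
have [->|S_n0] := eqVneq S set0; first by rewrite cards0.
have edge p : p \in S -> h p.1 p.2 by move/S_edges; rewrite inE.
have cross_clique : {in S &, forall p q, h p.1 q.2 || h q.1 p.2}.
  move=> p q pS qS; have := S_clique _ _ pS qS.
  case/andP: (S_side _ pS) => p1 p2; case/andP: (S_side _ qS) => q1 q2.
  rewrite /conflict (negPf (sphere2_indep p1 q1)) (negPf (sphere2_indep p2 q2)).
  by rewrite orbF /= [h p.2 _]h_sym.
have [x [y [hxy le]]] := clique_le_cross S_n0 edge cross_clique.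
(* With C the arcs in conflict with xy, [12 * cross x y <= 24 * d ^ 2 - 6 * #|C| < 7 * d ^ 2]; the
   term d^2 of [le], tripled, makes 10. *)
by have := conflict_gt hxy; have := conflict_cross hxy; lia.
Qed.

(** If an end of an arc is adjacent to [u], this end is two steps from [v] and the other end two
    steps from [u]; likewise with [u] and [v] exchanged. So [S] splits into two orientations, each
    within [clique_half]. *)
Lemma conflict_clique_bound u v (S : {set T * T}) :
  h u v -> {subset S <= arcs} -> {in S, forall p, conflict (u, v) p} ->
  {in S &, forall p q, conflict p q} ->
  6 * (#|[set p in arcs | conflict (u, v) p]| + #|S|) <= 2 * (17 * d ^ 2).
Proof.
move=> huv S_edges S_uv S_clique.
pose S1 := [set p in S | (p.1 \in sphere2 u) && (p.2 \in sphere2 v)].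
pose S2 := [set p in S | (p.1 \in sphere2 v) && (p.2 \in sphere2 u)].
have subS : S \subset S1 :|: S2.
  apply/subsetP => p pS; have hp := S_edges _ pS; rewrite inE in hp.
  have hvu : h v u by rewrite h_sym.
  have hp' : h p.2 p.1 by rewrite h_sym.
  rewrite !inE pS /=; apply/orP.
  have walk a b c : h a b -> h b c -> [exists w, h a w && h w c].
    by move=> hab hbc; apply/existsP; exists b; rewrite hab.
  case/or4P: (S_uv _ pS) => /= hup; [right | left | left | right]; apply/andP; split;
    by [apply: walk hvu hup | apply: walk huv hup | apply: walk hup hp | apply: walk hup hp'].
have half1 : 12 * #|S1| <= 10 * d ^ 2.
  apply: (@clique_half u v).
  - by move=> p; rewrite inE => /andP[/S_edges].
  - by move=> p q; rewrite !inE => /andP[pS _] /andP[qS _]; apply: S_clique.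
  - by move=> p; rewrite [_ \in S1]inE => /andP[].
have half2 : 12 * #|S2| <= 10 * d ^ 2.
  apply: (@clique_half v u).
  - by move=> p; rewrite inE => /andP[/S_edges].
  - by move=> p q; rewrite !inE => /andP[pS _] /andP[qS _]; apply: S_clique.
  - by move=> p; rewrite [_ \in S2]inE => /andP[].
(* The conflicts of uv contribute 24 d^2 and [S] contributes 10 d^2. A threshold t d^2 / 6 would
   require 24 + (27 - t) <= 2 t, and 17 is the least such t. *)
have := subset_leq_card subS; rewrite cardsU; have := conflict_cross huv; lia.
Qed.

End Counting.

(** * Induced matchings in regular graphs *)

Section RegularGraph.

Variables (T : finType) (G : sgraph T) (d : nat).

(** With V the vertices covered by a matching, 2 |V| d counts the arcs meeting V, those inside V
    twice; the latter are one per vertex of V. So |V| (2 d - 1) arcs meet V. *)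
Lemma nu2_le : regular G d -> 2 * nu2 G * (2 * d - 1) <= #|T| * d.
Proof.
move=> /forallP reg; have deg x : #|nbr G x| = d.
  have := reg x; rewrite inE => /implyP/(_ isT)/eqP <-.
  by apply: eq_card => y; rewrite !inE.
suff bound M : induced_matching G M -> 2 * #|M| * (2 * d - 1) <= #|T| * d.
  rewrite /nu2; elim/big_ind: _ => // a b; rewrite /maxn; case: ifP => //.
case/andP=> /subsetP M_edges /forallP V_reg; set V := cover M in V_reg.
have M_edge A : A \in M -> exists u v, [/\ adj G u v, A = [set u; v], u \in V & v \in V].
  move=> AM; have := M_edges A AM; rewrite inE => /existsP[u /existsP[v /andP[uv /eqP AE]]].
  by exists u, v; split=> //; apply/bigcupP; exists A; rewrite // AE !inE eqxx ?orbT.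
have one_nbr x y z : x \in V -> y \in V -> z \in V -> adj G x y -> adj G x z -> y = z.
  move=> xV yV zV xy xz; have := V_reg x; rewrite xV => /cards1P[w wE].
  have : y \in [set w] by rewrite -wE inE yV.
  have : z \in [set w] by rewrite -wE inE zV.
  by rewrite !inE => /eqP -> /eqP ->.
have cardV : #|V| = 2 * #|M|.
  rewrite /V; have /eqP <- : trivIset M.
    apply/trivIsetP => A B AM BM; apply: contraR => /pred0Pn[x /andP[/= xA xB]].
    have [u [v [uv AE uV vV]]] := M_edge A AM.
    have [u' [v' [uv' BE uV' vV']]] := M_edge B BM.
    have vu : adj G v u by rewrite adj_sym.
    have vu' : adj G v' u' by rewrite adj_sym.
    move: xA xB; rewrite {}AE {}BE !inE.
    case/orP => /eqP -> /orP[] /eqP E; subst; apply/eqP.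
    - by rewrite (one_nbr _ _ _ uV vV vV' uv uv').
    - by rewrite (one_nbr _ _ _ uV vV uV' uv vu') setUC.
    - by rewrite (one_nbr _ _ _ vV uV vV' vu uv') setUC.
    - by rewrite (one_nbr _ _ _ vV uV uV' vu vu').
  rewrite mulnC -sum_nat_const; apply: eq_bigr => A /M_edge[u [v [uv -> _ _]]].
  by rewrite cards2; case: eqP uv => // ->; rewrite adj_irr.
pose A1 := [set p : T * T | (p.1 \in V) && adj G p.1 p.2].
pose A2 := [set p : T * T | (p.2, p.1) \in A1].
have card1 : #|A1| = #|V| * d.
  rewrite (card_rel_in V (adj G)) -sum_nat_const.
  by apply: eq_bigr => x _; apply: deg.
have card2 : #|A2| = #|V| * d by rewrite card_swap.
have cardI : #|A1 :&: A2| = #|V|.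
  rewrite -[RHS]muln1 -sum_nat_const.
  rewrite -(eq_bigr _ (fun x xV => eqP (implyP (V_reg x) xV))).
  rewrite -(card_rel_in V (fun x y => (y \in V) && adj G x y)).
  by apply: eq_card => p; rewrite !inE /= [adj G p.2 _]adj_sym;
    case: (p.1 \in V); case: (p.2 \in V); case: (adj G _ _).
have cardU : #|A1 :|: A2| <= #|T| * d.
  have -> : #|T| * d = #|arcs (adj G)|.
    by rewrite card_rel -sum_nat_const; apply: eq_bigr => x _; rewrite -(deg x).
  apply: subset_leq_card; apply/subsetP => p.
  by rewrite !inE /= [adj G p.2 _]adj_sym -andb_orl => /andP[].
by move: cardU; rewrite cardsU card1 card2 cardI cardV; nia.
Qed.

Lemma conflict_sym : symmetric (conflict (adj G)).
Proof.
move=> p q; rewrite /conflict ![adj G q.1 _]adj_sym ![adj G q.2 _]adj_sym.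
by rewrite (orbCA (adj G p.2 q.1)).
Qed.

Lemma independent_inj (M : seq (T * T)) :
  independent (conflict (adj G)) M ->
  {in M &, forall p q, conflict (adj G) p q -> p = q}.
Proof.
elim: M => //= p M IH /andP[/allP pM ind] q r; rewrite !inE.
move=> /predU1P[->|qM] /predU1P[->|rM] //.
- by move=> c; have := pM _ rM; rewrite c.
- by rewrite conflict_sym => c; have := pM _ qM; rewrite c.
- exact: IH.
Qed.

Definition edge_set (M : seq (T * T)) : {set {set T}} :=
  [set [set p.1; p.2] | p in M].

(** Adjacent covered vertices put their arcs in conflict, so they are the two ends of a single arc
    of [M]. *)
Lemma independent_matching (M : seq (T * T)) :
  {in M, forall p, adj G p.1 p.2} -> independent (conflict (adj G)) M ->
  induced_matching G (edge_set M) /\ #|edge_set M| = size M.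
Proof.
move=> M_adj ind; have inj := independent_inj ind.
have conf_refl p : p \in M -> conflict (adj G) p p.
  by move=> pM; rewrite /conflict (M_adj p pM) orbT.
have [uM _] : uniq M /\ size M <= size M by apply: (independent_size (c := conflict (adj G))).
have cover_mem x : reflect (exists2 p, p \in M & (x == p.1) || (x == p.2))
    (x \in cover (edge_set M)).
  apply: (iffP bigcupP) => [[_ /imsetP[p pM ->]]|[p pM xp]].
    by rewrite !inE => xp; exists p.
  exists [set p.1; p.2]; last by rewrite !inE.
  by apply/imsetP; exists p.
split; last first.
  rewrite card_in_imset; first exact/card_uniqP.
  move=> p q pM qM pqE; apply: inj => //.
  have : p.1 \in [set q.1; q.2] by rewrite -pqE !inE eqxx.
  have := M_adj p pM; rewrite /conflict [adj G p.1 p.2]adj_sym !inE => pp.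
  by case/orP => /eqP <-; rewrite pp ?orbT.
apply/andP; split.
  apply/subsetP => _ /imsetP[p pM ->]; rewrite inE.
  by apply/existsP; exists p.1; apply/existsP; exists p.2; rewrite M_adj //=.
apply/forallP => x; apply/implyP => /cover_mem[p pM xp].
pose y := if x == p.1 then p.2 else p.1.
have xy : adj G x y.
  rewrite /y; case: eqP xp => [->|_ /eqP->]; first by rewrite M_adj.
  by rewrite adj_sym M_adj.
apply/cards1P; exists y; apply/setP => z; rewrite !inE; apply/andP/eqP => [[]|->]; last first.
  split=> //; apply/cover_mem; exists p => //; rewrite /y.
  by case: ifP; rewrite eqxx ?orbT.
case/cover_mem => q qM zq xz.
have pq : p = q.
  apply: inj => //; rewrite /conflict.
  by case/orP: xp xz => /eqP ->; case/orP: zq => /eqP -> ->; rewrite ?orbT.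
subst q; rewrite /y.
case/orP: zq => /eqP zE; subst z; case: eqP xp => [xE _|_ /eqP xE] //=;
  by move: xz; rewrite xE adj_irr.
Qed.

Hypothesis C3_free : cycle_free G 3.
Hypothesis C5_free : cycle_free G 5.

Lemma no_triangle x y z : adj G x y -> adj G y z -> adj G z x -> False.
Proof.
have neq u v : adj G u v -> u != v by apply: contraTneq => ->; rewrite adj_irr.
move=> xy yz zx; apply: (C3_free (c := [:: x; y; z])) => //.
rewrite /ucycle /ucycleb /= xy yz zx !inE /= negb_or !neq //.
by rewrite adj_sym.
Qed.

(** If two non-consecutive vertices coincided, the walk would contain a triangle; otherwise it is a
    cycle of length 5. *)
Lemma no_walk5 x1 x2 x3 x4 x5 :
  adj G x1 x2 -> adj G x2 x3 -> adj G x3 x4 -> adj G x4 x5 -> adj G x5 x1 -> False.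
Proof.
have neq u v : adj G u v -> u != v by apply: contraTneq => ->; rewrite adj_irr.
move=> h12 h23 h34 h45 h51.
have h15 : adj G x1 x5 by rewrite adj_sym.
have n13 : x1 != x3.
  by apply: contraPneq h34 => <- h14; apply: (no_triangle h14 h45 h51).
have n14 : x1 != x4.
  by apply: contraPneq h34 => <- h31; apply: (no_triangle h12 h23 h31).
have n24 : x2 != x4.
  by apply: contraPneq h45 => <- h25; apply: (no_triangle h12 h25 h51).
have n25 : x2 != x5.
  by apply: contraPneq h45 => <- h42; apply: (no_triangle h23 h34 h42).
have n35 : x3 != x5.
  by apply: contraPneq h51 => <- h31; apply: (no_triangle h12 h23 h31).
apply: (C5_free (c := [:: x1; x2; x3; x4; x5])) => //.
rewrite /ucycle /ucycleb /= h12 h23 h34 h45 h51 !inE !negb_or.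
by rewrite n13 n14 n24 n25 n35 !neq.
Qed.

Lemma residual_bound (E M1 U : seq (T * T)) e (Q : pred (T * T)) :
  regular G d -> uniq E -> (forall p, (p \in E) = adj G p.1 p.2) ->
  {subset M1 <= E} -> U = [seq e' <- E | unblocked (conflict (adj G)) M1 e'] ->
  e \in U ->
  {in U, forall e', 17 * d ^ 2 < 6 * count (conflict (adj G) e') U} ->
  {in Q, forall e', conflict (adj G) e e'} ->
  {in U &, forall a b, Q a -> Q b -> conflict (adj G) a b} ->
  6 * (count (conflict (adj G) e) U + count Q U) <= 2 * (17 * d ^ 2).
Proof.
move=> /forallP reg uE memE subM1 UE eU gtU Qe Q_clique.
(* [W] holds for the vertices not adjacent to any end of an arc of [M1]; it induces the subgraph H
   of the overview, with adjacency [h] and arcs exactly [U]. *)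
pose W x := ~~ has (fun p => adj G x p.1 || adj G x p.2) M1.
pose h x y := [&& adj G x y, W x & W y].
have memU p : (p \in U) = h p.1 p.2.
  rewrite UE mem_filter memE andbC /h; congr (_ && _).
  rewrite /unblocked /W -negb_or -has_predU; congr (~~ _); apply: eq_has => q.
  by rewrite /= /conflict !orbA.
have confE p q : p \in U -> q \in U -> conflict h p q = conflict (adj G) p q.
  rewrite !memU => /and3P[_ p1 p2] /and3P[_ q1 q2].
  by rewrite /conflict /h p1 p2 q1 q2 !andbT.
have uU : uniq U by rewrite UE filter_uniq.
have countE (P : pred (T * T)) : count P U = #|[set p in arcs h | P p]|.
  rewrite -size_filter -(card_uniqP (filter_uniq P uU)).
  by apply: eq_card => p; rewrite inE mem_filter memU !inE andbC.
have h_sym : symmetric h by move=> x y; rewrite /h adj_sym [W x && _]andbC.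
have h_adj x y : h x y -> adj G x y by case/and3P.
have deg x : #|nbr h x| <= d.
  have := reg x; rewrite inE => /implyP/(_ isT)/eqP <-.
  by apply: subset_leq_card; apply/subsetP => y; rewrite !inE => /h_adj.
have confU p : p \in U -> [set q in arcs h | conflict (adj G) p q] =
    [set q in arcs h | conflict h p q].
  move=> pU; apply/setP => q; rewrite !inE; case: (boolP (h q.1 q.2)) => //= hq.
  by symmetry; apply: confE => //; rewrite memU.
rewrite !countE (confU e eU) [in conflict h e](surjective_pairing e).
apply: (conflict_clique_bound h_sym deg).
- by move=> x y z /h_adj xy /h_adj yz /h_adj; apply: no_triangle xy yz.
- move=> x1 x2 x3 x4 x5 /h_adj h12 /h_adj h23 /h_adj h34 /h_adj h45 /h_adj.
  exact: no_walk5 h12 h23 h34 h45.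
- move=> x y hxy; have xyU : (x, y) \in U by rewrite memU.
  by rewrite -confU // -countE; apply: gtU.
- by rewrite -memU.
- by move=> p; rewrite inE => /andP[].
- move=> p; rewrite inE => /andP[pU Qp]; rewrite inE -memU in pU.
  by rewrite -surjective_pairing confE //; apply: Qe.
- move=> p q; rewrite inE => /andP[pU Qp]; rewrite inE => /andP[qU Qq].
  rewrite inE -memU in pU; rewrite inE -memU in qU.
  by rewrite confE //; apply: Q_clique.
Qed.

Lemma approx_independent_matching (E : seq (T * T))
    (M := approx_independent (conflict (adj G)) ((17 * d ^ 2) %/ 6) E) :
  regular G d -> uniq E -> (forall p, (p \in E) = adj G p.1 p.2) ->
  induced_matching G (edge_set M) /\
  12 * nu2 G * (2 * d - 1) <= 17 * d ^ 2 * #|edge_set M|.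
Proof.
move=> reg uE memE.
have conf_refl : {in E, forall p, conflict (adj G) p p}.
  by move=> p; rewrite memE /conflict => ->; rewrite orbT.
have [subM ind ratio] : [/\ {subset M <= E}, independent (conflict (adj G)) M &
    6 * size E <= 17 * d ^ 2 * size M].
  apply: (approx_independent_ratio conflict_sym) => // M1 U e Q; exact: residual_bound.
have M_adj : {in M, forall p, adj G p.1 p.2} by move=> p /subM; rewrite memE.
have [match_M ->] := independent_matching M_adj ind.
split=> //; have sizeE : size E = #|T| * d.
  rewrite -(card_uniqP uE) (eq_card (B := [set p : T * T | adj G p.1 p.2])).
    rewrite card_rel -sum_nat_const; apply: eq_bigr => x _.
    have /forallP/(_ x) := reg; rewrite inE => /implyP/(_ isT)/eqP <-.
    by apply: eq_card => y; rewrite !inE.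
  by move=> p; rewrite memE inE.
by have := nu2_le reg; rewrite sizeE in ratio; lia.
Qed.

End RegularGraph.

(** * The algorithm on encoded graphs *)

(** All sweeps are unrolled into one fold over pairs, whose first components only count the
    sweeps. *)
Lemma polytime_passes (step : tree -> seq tree -> tree -> seq tree) l m B :
  polytime (fun z => enc_seq (step (hd z) (dec (tl (tl z))) (hd (tl z)))) ->
  polytime l -> polytime m -> polybounded B ->
  (forall x M b, tree_size (enc_seq (step x M b)) <=
     tree_size (enc_seq M) + B (Node x b)) ->
  polytime (fun x => enc_seq (passes (step x) (dec (l x)) (dec (m x)))).
Proof.
move=> stepP lP mP bB growth.
have hdP := polytime_hd polytime_id; have tlP := polytime_tl polytime_id.
have := @polytime_foldl (fun x t y => enc_seq (step x (dec y) (tl t)))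
  _ (fun=> Leaf) (fun z => B (Node (hd z) (tl (tl z)))) _
  (polytime_allpairs lP mP) polytime_leaf _ _.
move=> foldP; apply: polytime_ext (foldP _ _ _).
- move=> x; rewrite encK /passes.
  have -> : flatten [seq dec (m x) | _ <- dec (l x)] =
      map tl [seq Node a b | a <- dec (l x), b <- dec (m x)].
    rewrite map_allpairs /= /allpairs_dep; congr flatten.
    by apply: eq_map => a; rewrite map_id.
  have gen s M : foldl (fun y t => enc_seq (step x (dec y) (tl t))) (enc_seq M) s =
      enc_seq (foldl (step x) M (map tl s)).
    by elim: s M => //= t s IH M; rewrite encK IH.
  exact: (gen _ [::]).
- apply: (polytime_comp stepP (f := fun z => Node (hd z) (Node (tl (hd (tl z))) (tl (tl z))))).
  do 2?apply: polytime_node; first exact: hdP.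
    exact: (polytime_tl (polytime_hd tlP)).
  exact: polytime_tl tlP.
- apply: polybounded_comp bB (polytime_size _).
  by apply: polytime_node; [exact: hdP | exact: polytime_tl tlP].
- by move=> x t y /=; have := growth x (dec y) (tl t); rewrite decK.
Qed.

Lemma size_enc_filter (p : pred tree) s :
  tree_size (enc_seq (filter p s)) <= tree_size (enc_seq s).
Proof. by elim: s => //= e s IH; case: (p e) => /=; lia. Qed.

(** * Running time of the two phases *)

Section PolytimeApprox.

Variables (c : rel tree) (f : nat).
Hypothesis polytime_c : forall u v, polytime u -> polytime v ->
  polytime (fun x => enc_bool (c (u x) (v x))).

Let hdP := polytime_hd polytime_id.
Let tlP := polytime_tl polytime_id.

Lemma polytime_unblocked u v : polytime u -> polytime v ->
  polytime (fun x => enc_bool (unblocked c (dec (u x)) (v x))).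
Proof.
move=> uP vP; apply: polytime_neg; apply: (polytime_has (p := fun x => c (v x))) => //.
by apply: polytime_c tlP; apply: (polytime_comp vP hdP).
Qed.

Lemma polytime_greedy l : polytime l ->
  polytime (fun x => enc_seq (greedy c f (dec (l x)))).
Proof.
move=> lP; apply: (@polytime_passes (fun x => greedy_step c f (dec (l x))) l l
  (fun z => 1 + tree_size z)) => //.
- have eP := polytime_hd tlP; have MP := polytime_tl tlP.
  have := polytime_ifb (c := fun z => unblocked c (dec (tl (tl z))) (hd (tl z)) &&
    (size [seq e' <- dec (l (hd z)) | unblocked c (dec (tl (tl z))) e' &&
       c (hd (tl z)) e'] <= f)) _ (polytime_node eP MP) MP.
  move=> ifP'; apply: polytime_ext (ifP' _).
    by move=> z; rewrite /greedy_step; case: ifP => _; rewrite /= ?decK.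
  apply: polytime_and; first exact: polytime_unblocked.
  (* The threshold enters the program as a constant list; [<= f] is tested as [< f.+1], whence its
     length. *)
  have fP := polytime_const (enc_seq (nseq f.+1 Leaf)).
  have filterP : polytime (fun z => enc_seq [seq e' <- dec (l (hd z)) |
      unblocked c (dec (tl (tl z))) e' && c (hd (tl z)) e']).
    apply: (polytime_filter (p := fun z e' =>
      unblocked c (dec (tl (tl z))) e' && c (hd (tl z)) e')).
      apply: polytime_and; first exact: (polytime_unblocked (polytime_tl (polytime_tl hdP)) tlP).
      exact: (polytime_c (polytime_hd (polytime_tl hdP)) tlP).
    exact: (polytime_comp lP hdP).
  apply: polytime_ext (polytime_ltn_size filterP fP) => z.
  by rewrite !encK size_nseq.
- by polybound.
- by move=> x M b; rewrite /greedy_step; case: ifP => _ /=; lia.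
Qed.

Lemma polytime_local_search l : polytime l ->
  polytime (fun x => enc_seq (local_search c (dec (l x)))).
Proof.
move=> lP.
pose step M t := exchange_step c M (hd t, tl t).
have pairsE x : local_search c (dec (l x)) = passes step (dec (l x))
    (dec (enc_seq [seq Node a b | a <- dec (l x), b <- dec (l x)])).
  rewrite encK /local_search -[RHS]map_id -(passes_map (k := id)
    (kc := fun t => (hd t, tl t)) (stepA := step) (stepB := exchange_step c)).
    by rewrite map_id map_allpairs.
  by move=> M t; rewrite !map_id.
apply: polytime_ext (fun x => congr1 enc_seq (esym (pairsE x))) _.
(* An exchange adds at most two elements, each with one [Node], and otherwise only deletes. *)
apply: (@polytime_passes (fun=> step) l _ (fun z => 2 + 2 * tree_size z)) => //.
- have eP := polytime_hd tlP; have MP := polytime_tl tlP.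
  have aP := polytime_hd eP; have bP := polytime_tl eP.
  have keepP u v : polytime u -> polytime v -> polytime (fun z =>
      enc_seq [seq e <- dec (u z) | ~~ c (v z) e]).
    move=> uP vP; apply: (polytime_filter (p := fun z e => ~~ c (v z) e)) => //.
    by apply/polytime_neg/polytime_c/tlP; apply: (polytime_comp vP hdP).
  have exP : polytime (fun z => enc_seq (exchange c (dec (tl (tl z)))
      (hd (hd (tl z))) (tl (hd (tl z))))).
    have both := keepP _ _ (keepP _ _ MP bP) aP.
    have := polytime_node aP (polytime_ifb (polytime_c aP bP) (keepP _ _ MP aP)
      (polytime_node bP both)).
    apply: polytime_ext => z; rewrite /exchange /= encK -filter_predI.
    by case: (c _ _).
  have := polytime_ifb (polytime_ltn_size MP exP) exP MP.
  apply: polytime_ext => z; rewrite /step /exchange_step /= !encK.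
  by case: ifP => //; rewrite ?decK.
- exact: polytime_allpairs.
- by polybound.
- move=> x M t; rewrite /step /exchange_step /=; case: ifP => _; last by lia.
  have := size_hd t; have := size_tl t; rewrite /exchange /=.
  case: ifP => _ /=; last first.
    by have := size_enc_filter (fun e => ~~ c (hd t) e && ~~ c (tl t) e) M; lia.
  by have := size_enc_filter (fun e => ~~ c (hd t) e) M; lia.
Qed.

Lemma polytime_approx_independent l : polytime l ->
  polytime (fun x => enc_seq (approx_independent c f (dec (l x)))).
Proof.
move=> lP; have gP := polytime_greedy lP.
have UP : polytime (fun x => enc_seq [seq e <- dec (l x) | unblocked c (greedy c f (dec (l x))) e]).
  apply: (polytime_filter (p := fun x e => unblocked c (greedy c f (dec (l x))) e)) => //.
  apply: polytime_ext (polytime_unblocked (polytime_comp gP hdP) tlP) => z.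
  by rewrite encK.
apply: polytime_ext (polytime_cat (polytime_local_search UP) gP) => x.
by rewrite !encK.
Qed.

End PolytimeApprox.

(* A vertex carries its index and its row of the adjacency matrix, so that
   adjacency of two vertices can be decided from these alone. *)
Definition tree_adj v w := is_node (nth Leaf (dec (tl v)) (size (dec (hd w)))).

(** The length of the accumulator serves as the index of the next row. The list comes out reversed,
    whence [rev] in [arc_seq]. *)
Definition tree_vertices x :=
  foldl (fun y r => Node (Node (enc_nat (size (dec y))) r) y) Leaf (dec x).

Definition tree_arcs x :=
  enc_seq [seq e <- [seq Node a b | a <- dec (tree_vertices x), b <- dec (tree_vertices x)]
              | tree_adj (hd e) (tl e)].

Definition tree_conflict e e' :=
  [|| tree_adj (hd e) (hd e'), tree_adj (hd e) (tl e'),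
      tree_adj (tl e) (hd e') | tree_adj (tl e) (tl e')].

Definition tree_algorithm f x :=
  enc_seq [seq Node (hd (hd e)) (hd (tl e))
             | e <- approx_independent tree_conflict f (dec (tree_arcs x))].

Lemma polytime_adj u v : polytime u -> polytime v ->
  polytime (fun x => enc_bool (tree_adj (u x) (v x))).
Proof.
by move=> uP vP; apply/polytime_is_node/polytime_nth; [apply: polytime_hd | apply: polytime_tl].
Qed.

Lemma polytime_conflict u v : polytime u -> polytime v ->
  polytime (fun x => enc_bool (tree_conflict (u x) (v x))).
Proof.
move=> uP vP; have hu := polytime_hd uP; have tu := polytime_tl uP.
have hv := polytime_hd vP; have tv := polytime_tl vP.
by do ?apply: polytime_or; apply: polytime_adj.
Qed.

Lemma size_enc_nat m : tree_size (enc_nat m) = (2 * m).+1.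
Proof. by elim: m => //= m ->; lia. Qed.

Lemma enc_natE m : enc_nat m = enc_seq (nseq m Leaf).
Proof. by elim: m => //= m ->. Qed.

Lemma tree_vertices_rcons s r :
  tree_vertices (enc_seq (rcons s r)) =
  Node (Node (enc_nat (size s)) r) (tree_vertices (enc_seq s)).
Proof.
rewrite /tree_vertices !encK foldl_rcons; congr (Node (Node (enc_nat _) _) _).
by elim/last_ind: s => // s e IH; rewrite foldl_rcons /= IH size_rcons.
Qed.

(** Each step adds an index as long as the accumulator, so the growth depends on the latter; a
    quadratic bound on all prefixes is proved instead. *)
Lemma polytime_vertices : polytime tree_vertices.
Proof.
apply: (@polytime_foldl_bounded
  (fun _ r y => Node (Node (enc_nat (size (dec y))) r) y) id (fun=> Leaf)
  (fun x => 4 * (tree_size x * tree_size x) + 1)).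
- have hdP := polytime_hd polytime_id; have tlP := polytime_tl polytime_id.
  have yP := polytime_tl tlP.
  have natP : polytime (fun z => enc_nat (size (dec (tl (tl z))))).
    have := polytime_map (h := fun _ _ => Leaf) polytime_leaf yP.
    apply: polytime_ext => z; rewrite enc_natE; congr enc_seq.
    by elim: (dec _) => //= _ s ->.
  exact: polytime_node (polytime_node natP (polytime_hd tlP)) yP.
- exact: polytime_id.
- exact: polytime_leaf.
- by polybound.
move=> x i; rewrite -[take i (dec x)]encK -/(tree_vertices _).
have le : tree_size (enc_seq (take i (dec x))) <= tree_size x.
  rewrite -{2}(decK x) !size_enc_seq ltnS.
  by rewrite -{2}(cat_take_drop i (dec x)) big_cat leq_addr.
suff : forall s, tree_size (tree_vertices (enc_seq s)) <=
    4 * (tree_size (enc_seq s) * tree_size (enc_seq s)) + 1.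
  by move/(_ (take i (dec x))) => le'; apply: leq_trans le' _; nia.
elim/last_ind => // s r IH; rewrite tree_vertices_rcons /=.
have -> : tree_size (enc_seq (rcons s r)) = tree_size (enc_seq s) + (tree_size r).+1.
  by rewrite !size_enc_seq -cats1 big_cat big_seq1 addSn.
have : size s < tree_size (enc_seq s) by rewrite -{1}(encK s) size_dec.
by rewrite size_enc_nat; move: IH; set v := tree_size (tree_vertices _); nia.
Qed.

Lemma polytime_algorithm f : polytime (tree_algorithm f).
Proof.
have hdP := polytime_hd polytime_id; have tlP := polytime_tl polytime_id.
have arcsP : polytime tree_arcs.
  have := polytime_filter (p := fun _ e => tree_adj (hd e) (tl e)) _
    (polytime_allpairs polytime_vertices polytime_vertices).
  move=> filterP; apply: polytime_ext (filterP _) => [x|]; first by rewrite encK.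
  by apply: polytime_adj; [apply: polytime_hd | apply: polytime_tl].
have := polytime_approx_independent f polytime_conflict arcsP.
move/(polytime_map (h := fun _ e => Node (hd (hd e)) (hd (tl e)))) => mapP.
apply: polytime_ext (mapP _) => [x|]; first by rewrite encK.
by apply: polytime_node; apply: polytime_hd; [apply: polytime_hd | apply: polytime_tl].
Qed.

(** * The tree algorithm on the code of a graph *)

Section EncodedGraph.

Variables (n : nat) (G : sgraph 'I_n).

Definition tree_vertex (i : 'I_n) :=
  Node (enc_nat i) (enc_seq [seq enc_bool (adj G i j) | j <- enum 'I_n]).

Definition tree_arc (p : 'I_n * 'I_n) := Node (tree_vertex p.1) (tree_vertex p.2).

Definition arc_seq :=
  [seq p <- [seq (i, j) | i <- rev (enum 'I_n), j <- rev (enum 'I_n)] | adj G p.1 p.2].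

Lemma tree_adjE i j : tree_adj (tree_vertex i) (tree_vertex j) = adj G i j.
Proof.
rewrite /tree_adj /= encK enc_natE encK size_nseq (nth_map i) ?size_enum_ord //.
by rewrite nth_ord_enum is_node_bool.
Qed.

Lemma tree_verticesE :
  dec (tree_vertices (enc_graph G)) = map tree_vertex (rev (enum 'I_n)).
Proof.
pose row i := enc_seq [seq enc_bool (adj G i j) | j <- enum 'I_n].
(* The condition says that each vertex stands at its own index; it passes to prefixes, as induction
   from the right requires. *)
have gen (s : seq 'I_n) : map val s = iota 0 (size s) ->
    dec (tree_vertices (enc_seq (map row s))) = map tree_vertex (rev s).
  elim/last_ind: s => // s i IH; rewrite map_rcons size_rcons -addn1 iotaD -cats1.
  move/eqP; rewrite eqseq_cat ?size_map ?size_iota // => /andP[/eqP sE /eqP [iE]].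
  rewrite add0n in iE.
  by rewrite map_rcons tree_vertices_rcons /= IH // rev_rcons size_map -iE.
by apply: gen; rewrite val_enum_ord size_enum_ord.
Qed.

Lemma tree_arcsE : dec (tree_arcs (enc_graph G)) = map tree_arc arc_seq.
Proof.
rewrite /tree_arcs encK tree_verticesE allpairs_mapl allpairs_mapr.
rewrite -(map_allpairs tree_arc pair) filter_map; congr map.
by apply: eq_filter => p /=; rewrite tree_adjE.
Qed.

Lemma tree_algorithmE f :
  tree_algorithm f (enc_graph G) = enc_seq [seq Node (enc_nat uv.1) (enc_nat uv.2)
     | uv : 'I_n * 'I_n <- approx_independent (conflict (adj G)) f arc_seq].
Proof.
rewrite /tree_algorithm tree_arcsE (approx_independent_map (cA := conflict (adj G))).
  by rewrite -map_comp.
by move=> p q; rewrite /tree_conflict /= !tree_adjE.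
Qed.

Lemma arc_seq_uniq : uniq arc_seq.
Proof.
apply: filter_uniq; apply: allpairs_uniq; rewrite ?rev_uniq ?enum_uniq //.
by case=> i j [i' j'] _ _ [-> ->].
Qed.

Lemma mem_arc_seq p : (p \in arc_seq) = adj G p.1 p.2.
Proof.
rewrite mem_filter; case: (adj _ _ _) => //=; apply/allpairsP.
by exists p; rewrite !mem_rev !mem_enum -surjective_pairing.
Qed.

End EncodedGraph.

Lemma polytime_runs f : polytime f ->
  exists (p : prog) (q : {poly nat}), forall x, exists t,
    runs p x t (f x) /\ t <= (q.[tree_size x])%R.
Proof.
case=> _ [P [T [[c [k leT]] runP]]].
exists (P 0), (c%:P * 'X^k)%R => x.
have [t [s [ex le [_ val]]]] := runP 0 (upd (fun=> Leaf) 0 x).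
exists t; split; first by exists s; rewrite // val upd_eq.
rewrite hornerCM hornerXn; apply: leq_trans le _.
by rewrite upd_eq -[X in _ <= X]/(c * _); apply: leq_trans (leT x) _.
Qed.

(** * The performance ratio over the rationals *)

Import GRing.Theory Num.Theory.
Local Open Scope ring_scope.

Theorem theorem1 (d : nat) (hd : (3 <= d)%N) :
  (exists p : prog,
     approximation_algorithm (C3C5_free_regular d)
       (17 / 24 * d%:R + 17 * d%:R / (48 * d%:R - 24)) p)
  /\ 17 / 24 * d%:R + 17 * d%:R / (48 * d%:R - 24)
       <= 17 / 24 * d%:R + 425 / 1000 :> rat.
Proof.
have d_ge3 : 3 <= d%:R :> rat by rewrite (ler_nat _ 3).
have den_gt0 : 0 < 48 * d%:R - 24 :> rat by lra.
(* [17 * d / (48 * d - 24) <= 17 / 40] amounts to [3 <= d], with equality at 3. *)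
split; last by rewrite lerD2l (ler_pdivrMr _ _ den_gt0); lra.
pose f := ((17 * d ^ 2) %/ 6)%N.
have [p [q runs_p]] := polytime_runs (polytime_algorithm f).
exists p, q => n G [C3_free C5_free reg].
have [t [run_t t_le]] := runs_p (enc_graph G).
have [match_M ratio] := approx_independent_matching C3_free C5_free reg
  (arc_seq_uniq G) (mem_arc_seq G).
exists t, (tree_algorithm f (enc_graph G)).
exists (edge_set (approx_independent (conflict (adj G)) f (arc_seq G))).
split; [exact: run_t | exact: t_le | | exact: match_M |].
  by exists (approx_independent (conflict (adj G)) f (arc_seq G)); first exact: tree_algorithmE.
set m := #|_| in ratio *.
have ratioQ : 12 * (nu2 G)%:R * (2 * d%:R - 1) <= 17 * d%:R ^+ 2 * m%:R :> rat.
  move: ratio; rewrite -(ler_nat rat) !natrM natrB; last by lia.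
  by rewrite natrM expr2.
(* The ratio is [17 * d / 24] times [1 + 1 / (2 * d - 1)], that is, [2 * d / (2 * d - 1)]. *)
have -> : 17 / 24 * d%:R + 17 * d%:R / (48 * d%:R - 24) =
    17 * d%:R ^+ 2 / (12 * (2 * d%:R - 1)) :> rat.
  by field; apply/andP; split; lra.
have den'_gt0 : 0 < 12 * (2 * d%:R - 1) :> rat by lra.
by rewrite mulrAC (ler_pdivlMr _ _ den'_gt0) mulrA [_ * 12]mulrC.
Qed.
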